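(* Let $R$ and $S$ be connected graphs with $R\neq P_3$ and $S\neq P_3$. Then the statement ''every $2$-connected $\{R,S\}$-heavy graph is Hamiltonian'' holds if and only if, up to interchanging $R$ and $S$, $R=K_{1,3}$ and $S$ is one of $P_4,P_5,C_3,Z_1,Z_2,B,N$ or $W$.
   Context: All graphs are finite and simple. Let $G$ be a graph on $n$ vertices. An induced subgraph $H'$ of $G$ is called heavy if there exist two nonadjacent vertices in $H'$ whose degree sum in $G$ is at least $n$. For a graph $H$, $G$ is $H$-heavy if every induced subgraph of $G$ isomorphic to $H$ is heavy; for a family $\mathcal{H}$, $G$ is $\mathcal{H}$-heavy if it is $H$-heavy for every $H\in\mathcal{H}$. Notation: $P_i$ is the path on $i$ vertices; $C_3$ is the triangle; $K_{1,3}$ is the claw (star with three leaves); $Z_i$ is the graph obtained from a triangle by attaching at one of its vertices a pendant path with $i$ edges (so $Z_i$ has $i+3$ vertices); $B$ (bull) is a triangle with a pendant edge attached at each of two distinct vertices; $N$ (net) is a triangle with a pendant edge attached at each of its three vertices; $W$ (wounded) is a triangle $abc$ with a pendant edge attached at $a$ and a pendant path of length $2$ attached at $b$.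
   Formalization: R and S are also required to have at least three vertices: for R equal to K_1 or K_2 no 2-connected graph is R-heavy, so the statement about Hamiltonicity holds vacuously for every S, although R and S are not on the list. *)

(* Defs.v *)
From HB Require Import structures.
From mathcomp Require Import all_boot.

Set Implicit Arguments.
Unset Strict Implicit.
Unset Printing Implicit Defensive.

Record sgraph := SGraph {
  vertex :> finType;
  adj : rel vertex;
  adj_sym : symmetric adj;
  adj_irrefl : irreflexive adj }.

Section Graphs.
Variable G : sgraph.

Definition deg (x : G) : nat := #|[set y | adj x y]|.

(* The empty graph is not connected. *)
Definition connected_graph : Prop :=
  0 < #|G| /\ forall x y : G, connect (@adj G) x y.

Definition hamiltonian : Prop :=
  exists c : seq G, [/\ ucycle (@adj G) c, 2 < size c & forall x : G, x \in c].

Section Induced.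
Variable A : {set G}.

Definition induced_adj : rel {x : G | x \in A} :=
  fun u v => adj (val u) (val v).

Lemma induced_sym : symmetric induced_adj.
Proof. by move=> u v; apply: adj_sym. Qed.

Lemma induced_irrefl : irreflexive induced_adj.
Proof. by move=> u; apply: adj_irrefl. Qed.

Definition induced : sgraph := SGraph induced_sym induced_irrefl.

(* Nonadjacent vertices are distinct; degrees and order are those of G. *)
Definition heavy_set : Prop :=
  exists x y : G, [/\ x \in A, y \in A, x != y, ~~ adj x y
                    & #|G| <= deg x + deg y].
End Induced.
End Graphs.

Definition kconnected (k : nat) (G : sgraph) : Prop :=
  k < #|G| /\
  forall X : {set G}, #|X| < k -> connected_graph (induced (~: X)).

Definition isomorphic (G H : sgraph) : Prop :=
  exists f : G -> H, bijective f /\ forall x y, adj (f x) (f y) = adj x y.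

Definition heavy (H G : sgraph) : Prop :=
  forall A : {set G}, isomorphic (induced A) H -> heavy_set A.

Definition family_heavy (F : sgraph -> Prop) (G : sgraph) : Prop :=
  forall H, F H -> heavy H G.

Definition pair_family (R S : sgraph) : sgraph -> Prop :=
  fun H => H = R \/ H = S.

(* The graph on {0, ..., n-1} whose edges are the pairs of distinct vertices
   related by r in at least one direction. *)
Section OrdGraph.
Variables (n : nat) (r : rel nat).

Definition ord_adj : rel 'I_n := fun i j => (i != j) && (r i j || r j i).

Lemma ord_adj_sym : symmetric ord_adj.
Proof. by move=> i j; rewrite /ord_adj eq_sym orbC. Qed.

Lemma ord_adj_irrefl : irreflexive ord_adj.
Proof. by move=> i; rewrite /ord_adj eqxx. Qed.

Definition ord_graph : sgraph := SGraph ord_adj_sym ord_adj_irrefl.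
End OrdGraph.

Definition edge_graph (n : nat) (s : seq (nat * nat)) : sgraph :=
  ord_graph n (fun i j => (i, j) \in s).

Definition path_graph (n : nat) : sgraph := ord_graph n (fun i j => j == i.+1).

Definition triangle : sgraph := edge_graph 3 [:: (0, 1); (1, 2); (0, 2)].

Definition claw : sgraph := edge_graph 4 [:: (0, 1); (0, 2); (0, 3)].

(* Triangle 0 1 2, with the pendant path 2, 3, ..., i + 2 attached at 2. *)
Definition Z_graph (i : nat) : sgraph :=
  ord_graph (i + 3) (fun u v => (v == u.+1) || ((u, v) == (0, 2))).

Definition bull : sgraph :=
  edge_graph 5 [:: (0, 1); (1, 2); (0, 2); (0, 3); (1, 4)].

Definition net : sgraph :=
  edge_graph 6 [:: (0, 1); (1, 2); (0, 2); (0, 3); (1, 4); (2, 5)].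

Definition wounded : sgraph :=
  edge_graph 6 [:: (0, 1); (1, 2); (0, 2); (0, 3); (1, 4); (4, 5)].

Definition heavy_partner (S : sgraph) : Prop :=
     isomorphic S (path_graph 4) \/ isomorphic S (path_graph 5)
  \/ isomorphic S triangle
  \/ isomorphic S (Z_graph 1) \/ isomorphic S (Z_graph 2)
  \/ isomorphic S bull \/ isomorphic S net \/ isomorphic S wounded.

(* Main.v *)
(** Call two vertices Ore-adjacent when they are adjacent or have degree sum at
    least n; by the proof of Ore's theorem a longest Ore-cycle can be taken to be a
    genuine cycle C, so no Ore-cycle is longer than C.  If C misses a vertex, take a
    shortest path z outside C between two vertices u, v of C, which split C into two
    arcs a and b.  The claw at u makes the first vertices of a and b Ore-adjacent.
    A "blob" at u consists of a prefix of each arc such that an Ore-path from u can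
    sweep one prefix completely together with any part of the other one and stop at
    the end of the first; an Ore-edge leaving the blob across the two arcs enlarges
    it, and blobs at u and at v never touch.  A heavy pair across the two arcs inside
    the blob at u cannot coexist with one at v, since regrouping the four degrees
    gives an Ore-edge closing a cycle longer than C.  Hence at one end the growth
    stops without a heavy pair.  Then one of the two prefixes is light, an induced
    path through it leads from z to the end of that prefix, and the other arc meets
    this path in exactly two consecutive vertices (no light claws): this is a light
    net, and it also yields a light wounded graph, possibly after counting the
    neighbours of u and of the second vertex of z.
    The remaining partners are induced subgraphs of the wounded graph.

    Conversely, K_{2,3} forces one of R, S to be the claw, and three claw-heavy
    non-Hamiltonian graphs on 9, 9 and 14 vertices have only the listed graphs as
    common connected induced non-heavy subgraphs; this is checked by computation. *)

Require Import Defs.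
From mathcomp Require Import all_boot.
From mathcomp Require Import zify.
From Stdlib Require Import Classical.

Set Implicit Arguments.
Unset Strict Implicit.
Unset Printing Implicit Defensive.

(** * Ore cycles *)

(** Each step of the walk contributes at most 1, through its end or through its start. This is the
    counting behind Ore's theorem. *)
Lemma count_no_consecutive (T : Type) (A B : pred T) x (p : seq T) :
  (forall p1 z p2, p = p1 ++ z :: p2 -> ~~ (B (last x p1) && A z)) ->
  count A p + count B (belast x p) <= size p.
Proof.
elim: p x => //= z p IHp x noc.
have /IHp: forall p1 y p2, p = p1 ++ y :: p2 -> ~~ (B (last z p1) && A y).
  by move=> p1 y p2 def_p; apply: (noc (z :: p1) y p2); rewrite def_p.
by move: (noc [::] z p erefl) => /=; case: (A z); case: (B x) => //=; lia.
Qed.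

Lemma first_exit (T : Type) (e : rel T) (P : pred T) x (s : seq T) :
  path e x s -> P x -> ~~ P (last x s) ->
  exists s1 y s2, [/\ s = s1 ++ y :: s2, path e x (rcons s1 y), all P (x :: s1) & ~~ P y].
Proof.
elim: s x => [|y s IHs] x /=; first by move=> _ ->.
case/andP=> exy ps Px nPl; case Py: (P y); last first.
  by exists [::], y, s; rewrite /= exy Px Py.
have [s1 [z [s2 [-> p1 a1 nz]]]] := IHs y ps Py nPl.
by exists (y :: s1), z, s2; rewrite /= exy p1 Px.
Qed.

Lemma path_threshold (T : Type) (e : rel T) (P : pred T) x (s : seq T) :
  path e x s -> P x -> ~~ P (last x s) ->
  exists s1 y s2, [/\ s = s1 ++ y :: s2, e (last x s1) y,
                      P (last x s1) & ~~ P y].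
Proof.
move=> p_s Px nPl; have [s1 [y [s2 [-> p1 a1 nPy]]]] := first_exit p_s Px nPl.
exists s1, y, s2; move: p1 a1; rewrite rcons_path lastI all_rcons.
by move=> /andP[_ ->] /andP[-> _].
Qed.

Section Ore.

Variable G : sgraph.
Implicit Types (x y z u v : G) (s p c a b X : seq G).

(** Equal arguments are allowed: [big_pair x x] says that the degree of [x] is at least half the
    order, which is used to find a light arm in [blob_step]. *)
Definition big_pair x y := #|G| <= deg x + deg y.
Definition ore x y := (x != y) && (adj x y || big_pair x y).
Definition far x y := (x != y) && ~~ ore x y.

Lemma big_pair_sym x y : big_pair x y = big_pair y x.
Proof. by rewrite /big_pair addnC. Qed.

Lemma ore_sym x y : ore x y = ore y x.
Proof. by rewrite /ore eq_sym adj_sym big_pair_sym. Qed.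

Lemma adj_neq x y : adj x y -> x != y.
Proof. by apply: contraTneq => ->; rewrite adj_irrefl. Qed.

Lemma adj_ore x y : adj x y -> ore x y.
Proof. by move=> axy; rewrite /ore axy adj_neq. Qed.

Lemma far_sym x y : far x y = far y x.
Proof. by rewrite /far eq_sym ore_sym. Qed.

Lemma far_nadj x y : far x y -> adj x y = false.
Proof. by rewrite /far /ore; case: (adj x y); rewrite ?andbF //= andbT; case: (x != y). Qed.

Lemma farE x y : far x y = [&& x != y, ~~ adj x y & ~~ big_pair x y].
Proof. by rewrite /far /ore; case: eqP => //= _; rewrite negb_or. Qed.

Lemma path_ore x s : path (@adj G) x s -> path ore x s.
Proof. by apply: sub_path => y z; apply: adj_ore. Qed.

Definition out_nbrs c x := [set y | adj x y & y \notin c].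

Lemma deg_out c x : uniq c -> deg x = count (adj x) c + #|out_nbrs c x|.
Proof.
move=> c_uniq; rewrite /deg -(cardsID [set y in c]).
have -> : [set y | adj x y] :\: [set y in c] = out_nbrs c x.
  by apply/setP=> y; rewrite !inE andbC.
congr (_ + _); rewrite -size_filter -(card_uniqP (filter_uniq _ c_uniq)).
by apply: eq_card => y; rewrite !inE mem_filter.
Qed.

Lemma card_out_nbrs2 c x y :
  uniq c -> #|out_nbrs c x| + #|out_nbrs c y|
     <= #|G| - size c + #|out_nbrs c x :&: out_nbrs c y|.
Proof.
move=> c_uniq; rewrite -cardsUI leq_add2r.
have <- : #|[set w in c]| = size c by rewrite cardsE; apply/card_uniqP.
have <- := cardsC [set w in c]; rewrite addKn.
by apply/subset_leq_card/subsetP=> w; rewrite !inE -andb_orl => /andP[].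
Qed.

Section Deficit.

Fixpoint deficit x s :=
  if s is y :: s' then ~~ adj x y + deficit y s' else 0.

Lemma deficit_cat x s1 s2 :
  deficit x (s1 ++ s2) = deficit x s1 + deficit (last x s1) s2.
Proof. by elim: s1 x => //= y s1 IHs x; rewrite IHs addnA. Qed.

Lemma deficit_rev x s : deficit (last x s) (rev (belast x s)) = deficit x s.
Proof.
elim: s x => //= y s IHs x; rewrite rev_cons -cats1 deficit_cat IHs /= addn0.
rewrite addnC; congr (_ + _); rewrite adj_sym.
by case: s {IHs} => //= z s; rewrite rev_cons last_rcons.
Qed.

Lemma deficit0 x s : deficit x s = 0 -> path (@adj G) x s.
Proof. by elim: s x => //= y s IHs x; case: adj => //= /IHs. Qed.

Lemma deficit_gt0 x s : 0 < deficit x s ->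
  exists s1 y s2, s = s1 ++ y :: s2 /\ ~~ adj (last x s1) y.
Proof.
elim: s x => //= y s IHs x; case axy: (adj x y) => /= def; last first.
  by exists [::], y, s; rewrite /= axy.
have [s1 [z [s2 [-> nadj]]]] := IHs y def.
by exists (y :: s1), z, s2.
Qed.

(* The proof of Ore's theorem: a heavy non-edge of the cycle is removed either
   by a rotation, or by inserting a common neighbour of its two ends. *)
Lemma ore_deficit_decr x p :
  uniq (x :: p) -> path ore x (rcons p x) -> ~~ adj (last x p) x ->
  (forall c, uniq c -> cycle ore c -> size c <= (size p).+1) ->
  exists y q, [/\ uniq (y :: q), path ore y (rcons q y), size q = size p
                & deficit y (rcons q y) < deficit x (rcons p x)].
Proof.
set y := last x p => c_uniq o_c nadj c_max.
have [o_p o_yx] : path ore x p /\ ore y x by apply/andP; rewrite -rcons_path.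
have heavy_yx : big_pair x y by case/andP: o_yx; rewrite (negPf nadj) big_pair_sym.
(* Look for a rotation: [x] is adjacent to an entry of [p], and [y] to the predecessor
   [last x (take i p)] of that entry on the cycle. *)
case: (boolP [exists i : 'I_(size p), adj x (nth x p i) && adj (last x (take i p)) y]).
  case/existsP=> i /andP[a1 a2].
  have def_p : p = take i p ++ nth x p i :: drop i.+1 p.
    by rewrite -drop_nth ?cat_take_drop.
  move: (nth x p i) (take i p) (drop i.+1 p) a1 a2 def_p => z p1 p2 a1 a2 def_p.
  have def_y : y = last z p2 by rewrite /y def_p last_cat.
  (* Read from [z] to [y], jump to the end of [p1] and return to [x]: both new steps are genuine
     edges, and the non-edge from [y] to [x] is gone. *)
  exists z, (p2 ++ rev (x :: p1)).
  have perm_c : perm_eq (z :: p2 ++ rev (x :: p1)) (x :: p).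
    by apply/permP=> P; rewrite def_p /= !count_cat count_rev /=; clear; lia.
  move: o_p; rewrite def_p cat_path /= => /and3P[o1 _ o2].
  have rev_ore : path ore (last x p1) (rev (belast x p1)).
    by rewrite rev_path (eq_path (e' := ore)) // => w w'; rewrite ore_sym.
  have rev_def : rev (x :: p1) = last x p1 :: rev (belast x p1).
    by rewrite lastI rev_rcons.
  have last_rev : last (last x p1) (rev (belast x p1)) = x.
    by case: (p1) => //= w s; rewrite rev_cons last_rcons.
  split.
  - by have := c_uniq; rewrite -(perm_uniq perm_c).
  - rewrite rcons_path cat_path o2 rev_def /= -def_y ore_sym adj_ore //= rev_ore.
    by rewrite last_cat /= last_rev adj_ore.
  - by have /perm_size[->] := perm_c; rewrite def_p.
  rewrite -!cats1 !deficit_cat !last_cat rev_def /= last_rev deficit_rev.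
  by rewrite /= -def_y adj_sym a2 a1 nadj /=; clear; lia.
move/existsPn=> nrot.
have cnt : count (adj x) p + count (adj y) (belast x p) <= size p.
  apply: count_no_consecutive => p1 z p2 def_p; rewrite andbC [adj y _]adj_sym.
  have lt_i : size p1 < size p by rewrite def_p size_cat /= -ltn_subLR // subnn.
  have := nrot (Ordinal lt_i).
  by rewrite /= {1 2}def_p nth_cat ltnn subnn take_size_cat.
have := card_out_nbrs2 x y c_uniq.
have := deg_out x c_uniq; have := deg_out y c_uniq.
have -> : count (adj y) (x :: p) = count (adj y) (belast x p).
  by rewrite lastI -cats1 count_cat /= adj_irrefl !addn0.
rewrite /= [adj x x]adj_irrefl add0n => dy dx out2.
have le_n : (size p).+1 <= #|G|.
  by rewrite -[(size p).+1]/(size (x :: p)) -(card_uniqP c_uniq) max_card.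
(* Without a rotation, [x] and [y] together have at most [size p] neighbours on a cycle of
   [(size p).+1] vertices, so their degree sum forces a common neighbour outside. *)
have : 0 < #|out_nbrs (x :: p) x :&: out_nbrs (x :: p) y|.
  have arith i j ox oy oi n m : i + j <= m -> ox + oy <= n - m.+1 + oi ->
    m < n -> n <= i + ox + (j + oy) -> 0 < oi by clear; lia.
  apply: (arith _ _ _ _ _ _ _ cnt out2 le_n).
  by move: heavy_yx; rewrite /big_pair dx dy.
case/card_gt0P=> w; rewrite !inE => /andP[/andP[axw w_out] /andP[ayw _]].
have := c_max (w :: x :: p); rewrite /= !inE w_out -[(x \notin p) && _]/(uniq (x :: p)).
rewrite c_uniq rcons_path o_p /= adj_ore ?adj_ore // 1?adj_sym // ltnn.
by move=> /(_ isT isT).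
Qed.

(** Induction on the number of non-edges: rotate the cycle until a non-edge becomes its closing
    step, then apply [ore_deficit_decr]. *)
Lemma ore_cycle_adj x p :
  uniq (x :: p) -> path ore x (rcons p x) ->
  (forall c, uniq c -> cycle ore c -> size c <= (size p).+1) ->
  exists y q, [/\ uniq (y :: q), path (@adj G) y (rcons q y) & size q = size p].
Proof.
have [m] := ubnP (deficit x (rcons p x)).
elim: m => // m IHm in x p *; move=> lt_m c_uniq o_c c_max.
have [d0 | /deficit_gt0 [s1 [y [s2 [def_s nadj]]]]] := posnP (deficit x (rcons p x)).
  by exists x, p; split=> //; apply: deficit0.
suff [z [q [z_uniq o_q q_size lt_d]]] : exists z q,
    [/\ uniq (z :: q), path ore z (rcons q z), size q = size p
      & deficit z (rcons q z) < deficit x (rcons p x)].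
  have [||y' [q' [? ? sz]]] := IHm z q _ z_uniq o_q; first by lia.
    by rewrite q_size.
  by exists y', q'; rewrite sz.
case: (lastP s2) def_s => [|s2' x'].
  rewrite cats1 => /rcons_inj[def_s1 def_y]; subst s1 y.
  exact: ore_deficit_decr.
rewrite -rcons_cons -rcons_cat => /rcons_inj[def_p def_x]; subst x'.
have perm_c : perm_eq (y :: s2' ++ x :: s1) (x :: p).
  by apply/permP=> P; rewrite def_p /= !count_cat /=; clear; lia.
have sz : size (s2' ++ x :: s1) = size p by have /perm_size[] := perm_c.
have def_d : deficit y (rcons (s2' ++ x :: s1) y) = deficit x (rcons p x).
  by rewrite -!cats1 def_p !deficit_cat /= !last_cat /=; clear; lia.
rewrite -def_d -sz; apply: ore_deficit_decr.
- by have := c_uniq; rewrite -(perm_uniq perm_c).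
- move: o_c; rewrite def_p !rcons_path !cat_path !last_cat /=.
  by move=> /andP[/andP[-> /andP[-> ->]] ->].
- by rewrite last_cat /=.
- by rewrite sz.
Qed.

End Deficit.
End Ore.

(** * Closing longer cycles *)

Ltac count_perm :=
  apply/permP=> ?; rewrite -?cats1 /=;
  do ?[progress rewrite ?(count_cat, count_rev) /=]; by clear; lia.

Section Links.

Variable G : sgraph.
Implicit Types (x y u v w : G) (s p c a b z X : seq G).
Local Notation ore := (@ore G).
Local Notation far := (@far G).

(** The vertices are taken up to permutation, so a path glued from several pieces is compared with
    the arcs by counting alone. *)
Definition link x y X :=
  exists s, [/\ path ore x s, last x s = y & perm_eq (x :: s) X].

Lemma link_refl x : link x x [:: x].
Proof. by exists [::]. Qed.

Lemma link_perm x y X X' : perm_eq X X' -> link x y X -> link x y X'.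
Proof.
by move=> eqX [s [o_s <- perm_s]]; exists s; split=> //; apply: perm_trans eqX.
Qed.

Lemma link_cat x y x' y' X X' :
  link x y X -> ore y x' -> link x' y' X' -> link x y' (X ++ X').
Proof.
case=> s [o_s <- perm_s] o_y [s' [o_s' <- perm_s']]; exists (s ++ x' :: s').
by rewrite cat_path o_s /= o_y o_s' last_cat; split=> //; rewrite -cat_cons perm_cat.
Qed.

Lemma link_ext x y X s : link x y X -> path ore y s -> link x (last y s) (X ++ s).
Proof.
case=> s0 [o_s <- perm_s] o_y; exists (s0 ++ s).
by rewrite cat_path o_s o_y last_cat; split=> //; rewrite -cat_cons perm_cat2r.
Qed.

Lemma path_back_rcons w s w' :
  path ore w (rcons s w') -> path ore w' (rcons (rev s) w).
Proof.
move=> o_s; have := rev_path ore w (rcons s w').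
rewrite last_rcons belast_rcons rev_cons (eq_path (e' := ore)) => [->//|x y].
by rewrite ore_sym.
Qed.

Lemma path_back w s w' : path ore w (rcons s w') -> path ore w' (rev s).
Proof. by move/path_back_rcons; rewrite rcons_path => /andP[]. Qed.

Lemma last_rev x s : last x (rev s) = head x s.
Proof. by case: s => //= y s; rewrite rev_cons last_rcons. Qed.

Lemma link_sym x y X : link x y X -> link y x X.
Proof.
case=> s [o_s <- perm_s]; case/lastP: s => [|s y'] in o_s perm_s *.
  by exists [::].
exists (rev (x :: s)); rewrite last_rcons rev_cons; split.
- exact: path_back_rcons.
- by rewrite last_rcons.
by apply: perm_trans perm_s; count_perm.
Qed.

Lemma link_close x y X :
  link x y X -> ore y x -> exists c, cycle ore c /\ perm_eq c X.
Proof.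
case=> s [o_s <- perm_s] o_yx; exists (x :: s); split=> //=.
by rewrite rcons_path o_s.
Qed.

(** A longest Ore-cycle [u, a, v, rev b] with an ear [z]. All three lists are read from [u] to [v],
    which makes swapping the arcs and reversing everything symmetries. *)
Record conf u v a b z : Prop := Conf {
  conf_uniq : uniq (u :: v :: a ++ b ++ z);
  conf_a : path (@adj G) u (rcons a v);
  conf_b : path (@adj G) u (rcons b v);
  conf_z : path (@adj G) u (rcons z v);
  conf_z0 : 0 < size z;
  conf_max : forall c, uniq c -> cycle ore c -> size c <= (size a + size b).+2 }.

Lemma conf_swap u v a b z : conf u v a b z -> conf u v b a z.
Proof.
case=> U Ca Cb Cz z0 Cm; split=> //; last by rewrite addnC.
by rewrite (perm_uniq (_ : perm_eq _ (u :: v :: a ++ b ++ z))) //; count_perm.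
Qed.

Lemma rev_adj_path u s v :
  path (@adj G) u (rcons s v) -> path (@adj G) v (rcons (rev s) u).
Proof.
move=> p_s; have := rev_path (@adj G) u (rcons s v).
rewrite last_rcons belast_rcons rev_cons (eq_path (e' := @adj G)) => [->//|x y].
by rewrite adj_sym.
Qed.

Lemma conf_rev u v a b z : conf u v a b z -> conf v u (rev a) (rev b) (rev z).
Proof.
case=> U Ca Cb Cz z0 Cm; split; rewrite ?size_rev //; try exact: rev_adj_path.
by rewrite (perm_uniq (_ : perm_eq _ (u :: v :: a ++ b ++ z))) //; count_perm.
Qed.

Section Config.

Variables (u v : G) (a b z : seq G).
Hypothesis cf : conf u v a b z.

Lemma conf_close x y X j : 0 < j -> link x y X ->
  perm_eq X (u :: v :: a ++ b ++ take j z) -> ~ ore y x.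
Proof.
move=> j0 lX pX /(link_close lX)[c [o_c p_c]].
have p_c' := perm_trans p_c pX.
have := conf_max cf _ o_c; rewrite (perm_uniq p_c') (perm_size p_c').
have sub : subseq (u :: v :: a ++ b ++ take j z) (u :: v :: a ++ b ++ z).
  by rewrite /= !eqxx !cat_subseq // take_subseq.
move=> /(_ (subseq_uniq sub (conf_uniq cf))).
rewrite /= !size_cat size_take => le_c; have z0 := conf_z0 cf.
by move: le_c j0 z0; clear; case: ifP; lia.
Qed.

Lemma conf_close_full x y X : link x y X ->
  perm_eq X (u :: v :: a ++ b ++ z) -> ~ ore y x.
Proof. by move=> lX pX; apply: conf_close (conf_z0 cf) lX _; rewrite take_size. Qed.

Lemma ore_a : path ore u (rcons a v). Proof. exact: path_ore (conf_a cf). Qed.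
Lemma ore_b : path ore u (rcons b v). Proof. exact: path_ore (conf_b cf). Qed.
Lemma ore_z : path ore u (rcons z v). Proof. exact: path_ore (conf_z cf). Qed.

(** Sweep both prefixes, ending with [b1], follow the rest of [b] to [v], and come back along [a] to
    [x]. *)
Lemma link_tail a1 x a2 b1 b2 : a = a1 ++ x :: a2 -> b = b1 ++ b2 ->
  link u (last u b1) (u :: b1 ++ a1) -> link u x (u :: v :: a ++ b).
Proof.
move=> def_a def_b lk; have := ore_a; have := ore_b.
rewrite def_a def_b !rcons_cat !cat_path => /andP[_ o_b] /andP[_ o_a].
have := link_ext lk o_b; rewrite last_rcons => /link_ext /(_ (path_back o_a)).
by rewrite last_rev; apply: link_perm; count_perm.
Qed.

(** Run the path of [link_tail] backwards from [x] to [u] and continue along [z] to [w]: an Ore-edge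
    back to [x] would close too long a cycle. *)
Lemma z_far a1 x a2 b1 b2 w : a = a1 ++ x :: a2 -> b = b1 ++ b2 ->
  link u (last u b1) (u :: b1 ++ a1) -> w \in z -> ~ ore w x.
Proof.
move=> def_a def_b lk w_z; have /link_sym lk1 := link_tail def_a def_b lk.
have [z1 [z2 def_z]] : exists z1 z2, z = z1 ++ w :: z2.
  by case/splitPr: w_z => z1 z2; exists z1, z2.
have := ore_z; rewrite def_z -cat_rcons rcons_cat cat_path => /andP[o_z _].
have := link_ext lk1 o_z; rewrite last_rcons => lk2.
apply: (conf_close (j := (size z1).+1)) lk2 _ => //.
rewrite def_z -cat_rcons take_cat size_rcons ltnn subnn take0 cats0.
by count_perm.
Qed.

(** Sweep the prefixes, follow [b] to its last vertex, cross to the last vertex of [a] and return to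
    [x]. Reversed and prolonged through [z] to [v], this path covers everything. *)
Lemma end_far a1 x a2 b1 b2 : a = a1 ++ x :: a2 -> b = b1 ++ b2 ->
  ore (last u a) (last u b) ->
  link u (last u b1) (u :: b1 ++ a1) -> ~ ore v x.
Proof.
move=> def_a def_b o_ab lk; have := ore_a; have := ore_b.
rewrite {1}def_b def_a !rcons_cat !cat_path !rcons_path.
case/and3P=> _ o_b _ /andP[_ /andP[o_a _]].
have := link_ext lk o_b; rewrite -last_cat -def_b => lk1.
have o_back : path ore (last u b) (rev (x :: a2)).
  move: o_a o_ab; rewrite def_a last_cat /= lastI rev_rcons /= [ore (last u b) _]ore_sym.
  by rewrite -/(path ore _ (x :: a2)) lastI => /path_back -> ->.
have := link_ext lk1 o_back; rewrite last_rev => /link_sym lk2.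
have := link_ext lk2 ore_z; rewrite last_rcons => lk3.
by apply: conf_close_full lk3 _; rewrite def_a def_b; count_perm.
Qed.

(** The forbidden cycle follows the sweep at [v], goes back along [a2] to [x], over the chord to
    [y], back along [b2] into the sweep at [u], and home through [z]. *)
Lemma no_chord a1 x a2 a3 b1 b2 y b3 :
  a = a1 ++ x :: a2 ++ a3 -> b = b1 ++ b2 ++ y :: b3 ->
  link u (last u b1) (u :: b1 ++ a1) ->
  link v (head v a3) (v :: a3 ++ b3) -> ~ ore x y.
Proof.
move=> def_a def_b lk lk'.
have := ore_a; rewrite (def_a : a = a1 ++ (x :: a2) ++ a3) !rcons_cat !cat_path.
have -> : rcons a3 v = head v a3 :: behead (rcons a3 v) by case: (a3).
case/and3P=> _ o1 /andP[o2 _].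
have /path_back o_a : path ore (last u a1) (rcons (x :: a2) (head v a3)).
  by rewrite rcons_path o1 o2.
have := link_ext lk' o_a; rewrite last_rev /= => /link_sym lk1.
have := link_ext lk1 (path_back_rcons ore_z); rewrite last_rcons => lk2.
have := ore_b; rewrite def_b -cat_rcons !rcons_cat !cat_path.
case/and3P=> _ o_b _.
case: lk => s [o_s l_s]; rewrite perm_cons => /permP p_s.
have := link_ext lk2 o_s; rewrite l_s => /link_ext /(_ o_b).
rewrite last_rcons ore_sym => lk3; apply: conf_close_full lk3 _.
apply/permP=> P; rewrite def_a def_b -!cats1 /= !(count_cat, count_rev) /= p_s.
by rewrite !(count_cat, count_rev) /=; clear; lia.
Qed.

(** If the swept parts met on [a], the two sweeps, joined by [z] at one end and by [b2] at the
    other, would form a cycle through the whole configuration. *)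
Lemma no_touch a1 a3 b1 b2 b3 : a = a1 ++ a3 -> b = b1 ++ b2 ++ b3 ->
  link u (last u b1) (u :: b1 ++ a1) ->
  ~ link v (head v b3) (v :: b3 ++ a3).
Proof.
move=> def_a def_b lk lk'.
have := ore_b; rewrite def_b !rcons_cat !cat_path.
have -> : rcons b3 v = head v b3 :: behead (rcons b3 v) by case: (b3).
case/and3P=> _ o_b1 /andP[o_b2 _].
have o_b : path ore (last u b1) (rcons b2 (head v b3)) by rewrite rcons_path o_b1.
have := ore_z; rewrite rcons_path => /andP[o_z o_zv].
have := link_cat (link_ext (link_sym lk) o_z) o_zv lk'.
move=> /link_ext /(_ (path_back o_b)); rewrite last_rev => lk2.
apply: conf_close_full lk2 _ _; first by rewrite def_a def_b; count_perm.
by case: (b2) o_b => [|y b4] /= /andP[o _]; rewrite ore_sym.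
Qed.
End Config.
End Links.

(** * Induced nets and wounded graphs *)

(** A chord shortens the path, so induction on the length ends at a chordless path on some of the
    given vertices. *)
Lemma induced_path (T : eqType) (e : rel T) x (p : seq T) : path e x p ->
  exists q, [/\ path e x q, last x q = last x p, {subset q <= p}, uniq (x :: q)
    & forall i j, i.+1 < j -> j <= size q -> ~~ e (nth x (x :: q) i) (nth x (x :: q) j)].
Proof.
have [m] := ubnP (size p); elim: m => // m IHm in p *; move=> lt_m p_path.
case/shortenP: (p_path) => q q_path q_uniq q_sub.
have lt_q : size q <= size p.
  by case/andP: q_uniq => _ /uniq_leq_size; apply=> y /q_sub.
case: (boolP [exists i : 'I_(size q).+1, exists j : 'I_(size q).+1,
               (i.+1 < j) && e (nth x (x :: q) i) (nth x (x :: q) j)]).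
  case/existsP=> i /existsP[j /andP[lt_ij e_ij]].
  have [i' def_i] : exists i' : nat, i' = i by exists i.
  case: j lt_ij e_ij => [[|j] /= lt_j]; rewrite -?def_i // => lt_ij e_ij.
  have def_q : q = take j q ++ nth x q j :: drop j.+1 q.
    by rewrite -drop_nth ?cat_take_drop.
  have last_i : last x (take i' q) = nth x (x :: q) i'.
    rewrite (last_nth x) size_takel; last lia.
    by case: i' lt_ij {def_i e_ij} => //= i' lt; rewrite nth_take.
  pose r := take i' q ++ nth x q j :: drop j.+1 q.
  have r_path : path e x r.
    move: (q_path); rewrite {1}def_q !cat_path /= => /and3P[_ _ ->].
    by rewrite last_i e_ij !andbT take_path.
  have r_last : last x r = last x q by rewrite [in RHS]def_q /r !last_cat.
  have [|s [s_path s_last s_sub s_uniq s_ind]] := IHm r _ r_path.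
    rewrite /r size_cat /= size_drop size_takel;
      by move: lt_q lt_m lt_ij lt_j; clear; lia.
  exists s; split=> //; first by rewrite s_last r_last.
  move=> y /s_sub; rewrite mem_cat => /orP[/mem_take | ] //; first exact: q_sub.
  by rewrite -drop_nth // => /mem_drop; apply: q_sub.
move/existsPn=> noc; exists q; split=> // i j lt_ij le_j.
have lt_i : i < (size q).+1 by lia.
have /existsPn/(_ (Ordinal (le_j : j < (size q).+1))) := noc (Ordinal lt_i).
by rewrite /= lt_ij.
Qed.

Section Core.

Variable G : sgraph.
Implicit Types (x y u v w z : G) (s p : seq G).
Local Notation ore := (@ore G).
Local Notation far := (@far G).
Local Notation big_pair := (@big_pair G).

(** Stated contrapositively: with every non-edge [far], the pattern would be an induced copy that is
    not heavy. Nets and wounded graphs get the same form. *)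
Definition claws_heavy := forall c x y w : G,
  adj c x -> adj c y -> adj c w -> far x y -> far x w -> ~ far y w.

Definition nets_heavy := forall x0 x1 x2 x3 x4 x5 : G,
  adj x0 x1 -> adj x1 x2 -> adj x0 x2 -> adj x0 x3 -> adj x1 x4 -> adj x2 x5 ->
  far x0 x4 -> far x0 x5 -> far x1 x3 -> far x1 x5 -> far x2 x3 -> far x2 x4 ->
  far x3 x4 -> far x3 x5 -> ~ far x4 x5.

Definition woundeds_heavy := forall x0 x1 x2 x3 x4 x5 : G,
  adj x0 x1 -> adj x1 x2 -> adj x0 x2 -> adj x0 x3 -> adj x1 x4 -> adj x4 x5 ->
  far x0 x4 -> far x0 x5 -> far x1 x3 -> far x1 x5 -> far x2 x3 -> far x2 x4 ->
  far x2 x5 -> far x3 x4 -> ~ far x3 x5.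

(** It supplies a pendant path [z1, z2] at [u] when the arms are too short to contain a pendant path
    of length 2. *)
Definition tail_witness z1 u s :=
  exists z2, [/\ adj z1 z2, far z2 u & forall w, w \in s -> far z2 w].

(** A chordless path [Y] runs from [z1] through [u] and [B] to its end. The other arm starts next to
    [Y] and ends away from it, so some edge [x x'] of it leaves the neighbourhood of [Y]. Claws then
    force the neighbours of [x] on [Y] to be exactly two consecutive vertices, which gives a
    triangle with pendant edges at all corners. *)
Lemma no_three_exits u z1 a1 A B :
  path (@adj G) u (a1 :: A) -> path (@adj G) u B -> adj u z1 ->
  uniq (u :: (a1 :: A) ++ B) ->
  (forall w, w \in (a1 :: A) ++ B -> far z1 w) ->
  (forall x y, x \in u :: a1 :: A -> y \in u :: B -> x != y -> ~~ big_pair x y) ->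
  (forall x y, x \in B -> y \in B -> ~~ big_pair x y) ->
  (forall y, y \in u :: B -> ~~ adj (last a1 A) y) ->
  B != [::] ->
  (forall x, x \in u :: a1 :: A -> ~~ adj (last u B) x) ->
  claws_heavy ->
  ~ (nets_heavy \/ woundeds_heavy /\ tail_witness z1 u ((a1 :: A) ++ B)).
Proof.
move=> pA pB uz1 U z1_far cross light endA B0 endB claw pats.
have [ys [ys_path ys_last ys_sub ys_uniq ys_ind]] := induced_path pB.
set f := last u B in endB ys_last.
have f_B : f \in B by rewrite /f; case: (B) B0 => //= y s _; apply: mem_last.
have u_notin w : w \in (a1 :: A) ++ B -> w != u.
  by move=> w_in; case/andP: U => u_out _; apply: contraNneq u_out => <-.
have ys0 : 0 < size ys.
  case: ys ys_last {ys_path ys_sub ys_uniq ys_ind} => //= def_u.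
  by have := u_notin f; rewrite mem_cat f_B orbT -def_u eqxx => /(_ isT).
(* Thus [Y 0 = z1], [Y 1 = u], entry [i] of [ys] is [Y i.+2], and [N] is the number of vertices of
   the path. *)
pose Y i := nth u (z1 :: u :: ys) i; pose N := (size ys).+2.
have YB i : i < size ys -> Y i.+2 \in B by move=> lt_i; apply/ys_sub/mem_nth.
have YuB i : i <= size ys -> Y i.+1 \in u :: B.
  by case: i => [|i] le_i; rewrite inE ?eqxx // YB ?orbT.
have Yf : Y (size ys).+1 = f by rewrite /Y /= -ys_last (last_nth u).
have adjY i : i.+1 < N -> adj (Y i) (Y i.+1).
  case: i => [|i] lt_i; first by rewrite adj_sym.
  by move/(pathP u): ys_path => /(_ i); apply.
have farY i j : i.+1 < j -> j < N -> far (Y i) (Y j).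
  case: j => // -[//|j]; case: i => [|i] lt_ij lt_j.
    by apply: z1_far; rewrite mem_cat YB ?orbT //; lia.
  have lt_j' : j < size ys by [].
  rewrite farE; apply/and3P; split.
  - rewrite -[Y i.+1]/(nth u (u :: ys) i) -[Y j.+2]/(nth u (u :: ys) j.+1).
    have lt_i : i < j by [].
    by rewrite nth_uniq //= ?neq_ltn ltnS ltnW // (ltn_trans lt_i).
  - exact: (ys_ind i j.+1).
  case: i lt_ij => [|i] lt_ij; last by apply: light; apply: YB; lia.
  apply: cross; rewrite ?inE ?eqxx ?YB ?orbT //.
  by rewrite eq_sym u_notin // mem_cat YB ?orbT.
pose P x := has (adj x) (u :: ys).
have [s1 [x' [s2 [def_A xx' Px nPx']]]] : exists s1 y s2,
    [/\ A = s1 ++ y :: s2, adj (last a1 s1) y, P (last a1 s1) & ~~ P y].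
  apply: path_threshold.
  - by case/andP: pA.
  - by rewrite /P /= adj_sym; case/andP: pA => ->.
  apply/hasPn=> y; rewrite inE => y_in; apply: endA; rewrite inE.
  by case/orP: y_in => [->//|/ys_sub->]; rewrite orbT.
set x := last a1 s1 in xx' Px.
have xA : x \in a1 :: A.
  rewrite def_A -cat_cons mem_cat /x; apply/orP; left; exact: mem_last.
have x'A : x' \in a1 :: A by rewrite def_A inE mem_cat inE eqxx !orbT.
have neqAY w i : w \in a1 :: A -> i < N -> w != Y i.
  move=> wA; case: i => [|i] lt_i.
    have /z1_far : w \in (a1 :: A) ++ B by rewrite mem_cat wA.
    by case/andP; rewrite eq_sym.
  have := YuB i lt_i; rewrite inE => /orP[/eqP-> | YiB].
    by rewrite u_notin // mem_cat wA.
  move: U; rewrite cons_uniq cat_uniq => /and4P[_ _ /hasPn/(_ _ YiB) nA _].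
  by apply: contraNneq nA => <-.
have farAY w i : w \in a1 :: A -> i < N -> ~~ adj w (Y i) -> far w (Y i).
  move=> wA lt_i nadj; case: i => [|i] in lt_i nadj *.
    by rewrite far_sym z1_far // mem_cat wA.
  by rewrite farE nadj neqAY // cross ?neqAY ?YuB // inE wA orbT.
have farx' i : i < N -> far x' (Y i).
  move=> lt_i; apply: farAY => //; case: i => [|i] in lt_i *.
    by rewrite adj_sym far_nadj // z1_far // mem_cat x'A.
  by move/hasPn: nPx'; apply; apply: (@mem_nth _ u (u :: ys) i).
have adjx0 : adj x (Y 0) = false.
  by rewrite adj_sym far_nadj // z1_far // mem_cat xA.
have adjxf : adj x f = false.
  by rewrite adj_sym; apply/negbTE/endB; rewrite inE xA orbT.
have [i ltiN xYi] : exists2 i, i < N & adj x (Y i).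
  case/(has_nthP u): Px => i lt_i; exists i.+1 => //.
have exJ : exists j, (j < N) && adj x (Y j) by exists i; rewrite ltiN.
(* [Y j] is the first neighbour of [x] on the path. It is not [z1], so from here on [j] is shifted
   and the first neighbour is [Y j.+1]. *)
case: (ex_minnP exJ) => j /andP[lt_j xYj] min_j {i ltiN xYi exJ}.
case: j => [|j] in lt_j xYj min_j *; first by rewrite adjx0 in xYj.
have far_x i : i <= j -> far x (Y i).
  move=> lt_ij; have lt_i : i < N by apply: leq_ltn_trans lt_ij (ltnW lt_j).
  apply: farAY => //; apply/negP=> xYi; have := min_j i.
  by rewrite lt_i xYi ltnNge lt_ij => /(_ isT).
have lt_j' : j.+2 < N.
  rewrite ltn_neqAle lt_j andbT; apply: contraTneq xYj => -[->].
  by rewrite Yf adjxf.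
(* Otherwise [x] and the two path neighbours of [Y j.+1] are the leaves of a light claw. *)
have xYj1 : adj x (Y j.+2).
  apply/idPn=> nadj; apply: (claw (Y j.+1) x (Y j) (Y j.+2)).
  - by rewrite adj_sym.
  - by rewrite adj_sym adjY.
  - exact: adjY.
  - exact: far_x.
  - exact: farAY.
  - exact: farY.
(* A third neighbour [Y k] would give a light claw at [x] with leaves [x'], [Y j.+1] and [Y k]. *)
have far_x2 k : j.+2 < k -> k < N -> far x (Y k).
  move=> lt_jk lt_k; apply: farAY => //; apply/negP=> xYk.
  apply: (claw x x' (Y j.+1) (Y k)) => //; try exact: farx'.
  exact: farY.
have lt_j2 : j.+3 < N.
  rewrite ltn_neqAle lt_j' andbT; apply: contraTneq xYj1 => -[->].
  by rewrite Yf adjxf.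
have lt_j0 : j < N by do 3 apply: ltnW.
have adjY' i : i.+1 < N -> adj (Y i.+1) (Y i) by move/adjY; rewrite adj_sym.
have adjx i : adj x i -> adj i x by rewrite adj_sym.
have farY' i k : i.+1 < k -> k < N -> far (Y k) (Y i).
  by move=> lt_ik lt_k; rewrite far_sym farY.
case: pats => [net | [wnd [z2 [z12 z2u z2_far]]]].
  apply: (net x (Y j.+1) (Y j.+2) x' (Y j) (Y j.+3)) => //; try exact: adjY;
    try exact: adjY'; try exact: farx'; try exact: farY; rewrite 1?far_sym.
  - by rewrite far_sym; apply: far_x.
  - by rewrite far_sym; apply: far_x2.
  - by apply: farx'.
  - by apply: farx'.
  - exact: farY.
(* For a triangle away from [u], the part of [Y] towards [z1] is the pendant path of length 2. For a
   triangle at [u], it is the part beyond the triangle if [Y] has at least five vertices, and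
   [z1, z2] if it has four. *)
case: j => [|j] in lt_j xYj min_j far_x lt_j' xYj1 far_x2 lt_j2 lt_j0 *; last first.
  apply: (wnd (Y j.+3) (Y j.+2) x (Y j.+4) (Y j.+1) (Y j)).
  - exact: adjY'.
  - exact: adjx.
  - exact: adjx.
  - exact: adjY.
  - exact: adjY'.
  - exact: adjY' (ltnW _).
  - exact: farY'.
  - exact: farY' (ltnW _) _.
  - exact: farY.
  - exact: farY'.
  - exact: far_x2.
  - exact: far_x.
  - exact: far_x (ltnW _).
  - exact: farY' (ltnW _) _.
  - exact: farY' (ltnW (ltnW _)) _.
have [lt4 | le4] := ltnP 4 N.
  apply: (wnd u (Y 2) x z1 (Y 3) (Y 4)) => //.
  - exact: (adjY 1).
  - exact: adjx.
  - exact: adjx.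
  - exact: adjY.
  - exact: adjY.
  - exact: (farY 1).
  - exact: (farY 1).
  - exact: (farY' 0).
  - exact: farY.
  - exact: (far_x 0).
  - exact: far_x2.
  - exact: far_x2.
  - exact: (farY 0).
  - exact: (farY 0).
have Y2B : Y 2 \in B by apply: YB.
have z2F w : (w \in a1 :: A) || (w \in B) -> far w z2.
  by move=> w_in; rewrite far_sym z2_far // mem_cat.
apply: (wnd x u (Y 2) x' z1 z2) => //.
- exact: (adjY 1).
- exact: (far_x 0).
- by rewrite z2F ?xA.
- by rewrite far_sym; apply: (farx' 1).
- by rewrite far_sym.
- by rewrite far_sym; apply: farx'.
- exact: (farY' 0).
- by rewrite z2F ?Y2B ?orbT.
- exact: (farx' 0).
- by rewrite z2F ?x'A.
Qed.

End Core.

(** * Blobs *)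

Lemma split_rcons (T : eqType) (s s1 s2 : seq T) x w :
  rcons s x = s1 ++ w :: s2 -> exists s3, s = s1 ++ s3.
Proof.
case/lastP: s2 => [|s2 y] def_s; last first.
  by exists (w :: s2); move: def_s; rewrite -rcons_cons -rcons_cat => /rcons_inj[].
by exists [::]; move: def_s; rewrite cats1 cats0 => /rcons_inj[].
Qed.

Lemma in_split (T : eqType) (x : T) s : x \in s -> exists s1 s2, s = s1 ++ x :: s2.
Proof. by case/splitPr=> s1 s2; exists s1, s2. Qed.

Lemma uniq_neq (T : eqType) (s1 s2 : seq T) x y :
  uniq (s1 ++ s2) -> x \in s1 -> y \in s2 -> x != y.
Proof.
rewrite cat_uniq => /and3P[_ /hasPn dis _] xs1 /dis.
by apply: contraNneq => <-.
Qed.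

Section Blobs.

Variable G : sgraph.
Implicit Types (x y u v w e f : G) (a b z s : seq G).
Local Notation ore := (@ore G).
Local Notation far := (@far G).
Local Notation big_pair := (@big_pair G).

(* All prefixes b0 of b are allowed, so that a chord closing a long cycle may leave
   b at any vertex. *)
Definition reach u a b :=
  forall b0 b', b = b0 ++ b' -> link u (last u a) (u :: a ++ b0).

Definition blob u a b := reach u a b /\ reach u b a.

Definition event u a b :=
  exists x y, [/\ x \in u :: a, y \in u :: b, x != y & big_pair x y].

Lemma blob_sym u a b : blob u a b -> blob u b a.
Proof. by case. Qed.

Lemma blob1 u x y : ore u x -> ore u y -> ore x y -> blob u [:: x] [:: y].
Proof.
move=> oux ouy oxy; have half x1 y1 : ore u x1 -> ore u y1 -> ore x1 y1 ->
    reach u [:: x1] [:: y1].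
  move=> o1 o2 o3 [|y2 [|//]] b'; first by exists [:: x1]; rewrite /= o1.
  case=> <- _; exists [:: y1; x1]; rewrite /= o2 [ore y1 x1]ore_sym o3; split=> //.
  by count_perm.
by split; apply: half; rewrite // ore_sym.
Qed.

Lemma reach_rcons_l u a b e :
  ore (last u a) e -> reach u a b -> reach u (rcons a e) b.
Proof.
move=> o_e ra b0 b' /ra lk; rewrite last_rcons.
by have := link_ext lk (_ : path ore _ [:: e]); rewrite /= o_e => /(_ isT);
  apply: link_perm; count_perm.
Qed.

(** Only the full prefix is new; every shorter one is already a prefix of [a]. *)
Lemma reach_rcons_r u a b e : reach u b a ->
  link u (last u b) (u :: b ++ rcons a e) -> reach u b (rcons a e).
Proof.
move=> rb lk a0; case/lastP => [|a' x]; first by rewrite cats0 => <-.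
by rewrite -rcons_cat => /rcons_inj[def_a _]; apply: rb def_a.
Qed.

(** The new task is a path over everything that stops at the end of [b]. If [w = u], go to [e]
    first, back along [a], and cross from [x] to [y]. If [w] lies in [b], sweep [a] with the part of
    [b] before [w], then pass through [e] to [w]. *)
Lemma blob_grow u x a y b e w :
  path ore u (rcons (x :: a) e) -> path ore u (y :: b) -> ore x y ->
  blob u (x :: a) (y :: b) -> w \in u :: y :: b -> ore e w ->
  blob u (rcons (x :: a) e) (y :: b).
Proof.
move=> o_a o_b o_xy [ra rb] wb o_ew.
have o_e : ore (last u (x :: a)) e by move: o_a; rewrite rcons_path => /andP[].
split; first exact: reach_rcons_l.
apply: reach_rcons_r => //; move: wb; rewrite inE => /orP[/eqP eq_w | w_b].
  subst w; exists (e :: rev (x :: a) ++ y :: b); split.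
  - rewrite /= ore_sym o_ew cat_path (path_back o_a) last_rev /= o_xy /=.
    by case/andP: o_b.
  - by rewrite /= last_cat.
  by count_perm.
have [b1 [b2 def_b]] := in_split w_b.
have p_e : path ore (last u (x :: a)) [:: e] by rewrite /= o_e.
have p_w : path ore e (w :: b2).
  by move: o_b; rewrite def_b cat_path /= o_ew => /and3P[].
have := link_ext (link_ext (ra _ _ def_b) p_e) p_w.
by rewrite def_b last_cat; apply: link_perm; count_perm.
Qed.

Lemma blob_grow2 u a b e f :
  ore (last u a) e -> ore (last u b) f -> ore e f ->
  blob u a b -> blob u (rcons a e) (rcons b f).
Proof.
move=> o_e o_f o_ef [ra rb].
have half a' b' e' f' : ore (last u a') e' -> ore (last u b') f' -> ore f' e' ->
    reach u a' b' -> reach u b' a' -> reach u (rcons a' e') (rcons b' f').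
  move=> o1 o2 o3 r1 r2; apply: reach_rcons_r; first exact: reach_rcons_l.
  have := link_ext (r2 _ _ (esym (cats0 a'))) (_ : path ore _ [:: f'; e']).
  rewrite /= o2 o3 last_rcons => /(_ isT).
  by apply: link_perm; count_perm.
by split; apply: half; rewrite // ore_sym.
Qed.

(** * Ore-edges excluded by a blob *)

Section Far.

Variables (u v : G) (a b z : seq G).
Hypothesis cf : conf u v a b z.
Variables (a1 : seq G) (e : G) (a' b1 b' : seq G).
Hypotheses (def_a : a = rcons a1 e ++ a') (def_b : b = b1 ++ b').
Hypothesis rb : reach u b1 a1.

Lemma conf_neq x y : x \in u :: a ++ b -> y \in v :: z -> x != y.
Proof.
apply: uniq_neq; rewrite (perm_uniq (_ : perm_eq _ (u :: v :: a ++ b ++ z))).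
  exact: conf_uniq cf.
by count_perm.
Qed.

(** The vertices before [w] form a prefix of [a1] even for [w = e], so the exclusions reach one
    vertex beyond the blob. *)
Lemma blob_split w : w \in rcons a1 e -> exists s1 s2,
  a = s1 ++ w :: s2 ++ a' /\ link u (last u b1) (u :: b1 ++ s1).
Proof.
case/in_split=> s1 [s2 def_s]; exists s1, s2.
by rewrite def_a def_s -catA; have [s3 /rb] := split_rcons def_s.
Qed.

Lemma blob_z_far w t : w \in rcons a1 e -> t \in z -> far t w.
Proof.
move=> w_a tz; have [s1 [s2 [def_a' lk]]] := blob_split w_a.
rewrite /far eq_sym conf_neq ?inE ?tz ?orbT //=; last first.
  by rewrite def_a !mem_cat w_a orbT.
by apply/negP; apply: (z_far cf def_a' def_b lk tz).
Qed.

Lemma blob_end_far w : ore (last u a) (last u b) -> w \in rcons a1 e -> far v w.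
Proof.
move=> o_ab w_a; have [s1 [s2 [def_a' lk]]] := blob_split w_a.
rewrite /far eq_sym conf_neq ?inE ?eqxx //=; last by rewrite def_a !mem_cat w_a orbT.
by apply/negP; apply: (end_far cf def_a' def_b o_ab lk).
Qed.

Lemma blob_no_chord a2 a3 b2 b3 w y :
  a' = a2 ++ a3 -> b' = b2 ++ b3 -> reach v (rev a3) (rev b3) ->
  w \in rcons a1 e -> y \in b3 -> far w y.
Proof.
move=> def_a' def_b' ra3 w_a y_b; have [s1 [s2 [def_a1 lk]]] := blob_split w_a.
have w_a' : w \in a by rewrite def_a mem_cat w_a.
have y_b' : y \in b by rewrite def_b def_b' !mem_cat y_b !orbT.
rewrite /far (uniq_neq (s1 := a) (s2 := b)) //=; last first.
  have := conf_uniq cf; rewrite !cons_uniq catA cat_uniq => /and3P[_ _].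
  by case/and3P.
have [t1 [t2 def_b3]] := in_split y_b; apply/negP.
apply: (@no_chord _ _ _ _ _ _ cf s1 w (s2 ++ a2) a3 b1 (b2 ++ t1) y t2) => //.
- by rewrite def_a1 def_a' -catA.
- by rewrite def_b def_b' def_b3 -catA.
have /ra3 : rev b3 = rev t2 ++ rev (rcons t1 y).
  by rewrite def_b3 -cat_rcons rev_cat.
by rewrite last_rev; apply: link_perm; count_perm.
Qed.

End Far.

Lemma far_sum x y : far x y -> deg x + deg y < #|G|.
Proof. by rewrite farE /big_pair -ltnNge => /and3P[]. Qed.

Lemma blob_facts u v a1 a2 a3 b1 b2 b3 z :
  conf u v (a1 ++ a2 ++ a3) (b1 ++ b2 ++ b3) z -> 0 < size a2 ->
  ore (last u (a1 ++ a2 ++ a3)) (last u (b1 ++ b2 ++ b3)) ->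
  reach u b1 a1 -> reach v (rev a3) (rev b3) ->
  forall w, w \in a1 ->
  [/\ far v w, forall y, y \in b3 -> far w y & forall t, t \in z -> far t w].
Proof.
case: a2 => // e a2 cf _ o_ab rb ra w w_a.
have def_a : a1 ++ (e :: a2) ++ a3 = rcons a1 e ++ (a2 ++ a3) by rewrite cat_rcons.
have w_a' : w \in rcons a1 e by rewrite mem_rcons inE w_a orbT.
split=> [|y|t]; first exact: (blob_end_far cf def_a erefl rb o_ab w_a').
  exact: (blob_no_chord cf def_a erefl rb erefl erefl ra w_a').
exact: (blob_z_far cf def_a erefl rb w_a').
Qed.

(* Two heavy pairs have degree sum at least 2n; splitting the four vertices into
   two other pairs, each taken across the two blobs, contradicts blob_facts. *)
Lemma events_clash u v a1 a2 a3 b1 b2 b3 z :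
  conf u v (a1 ++ a2 ++ a3) (b1 ++ b2 ++ b3) z ->
  0 < size a2 -> 0 < size b2 ->
  ore (last u (a1 ++ a2 ++ a3)) (last u (b1 ++ b2 ++ b3)) ->
  ore (head v (a1 ++ a2 ++ a3)) (head v (b1 ++ b2 ++ b3)) ->
  blob u a1 b1 -> blob v (rev a3) (rev b3) ->
  event u a1 b1 -> ~ event v (rev a3) (rev b3).
Proof.
move=> cf a2_0 b2_0 o_l o_h [ra rb] [ra3 rb3].
have fa := blob_facts cf a2_0 o_l rb ra3.
have fb : forall w, w \in b1 ->
    [/\ far v w, forall y, y \in a3 -> far w y & forall t, t \in z -> far t w].
  by apply: blob_facts (conf_swap cf) b2_0 _ ra rb3; rewrite ore_sym.
have cf' : conf v u (rev a3 ++ rev a2 ++ rev a1) (rev b3 ++ rev b2 ++ rev b1) (rev z).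
  by have := conf_rev cf; rewrite !rev_cat -!catA.
have o_l' : ore (last v (rev a3 ++ rev a2 ++ rev a1))
                (last v (rev b3 ++ rev b2 ++ rev b1)).
  by rewrite -!rev_cat !last_rev -!catA.
have fu w : w \in a3 \/ w \in b3 -> far u w.
  case=> w_in; last first.
    have := blob_facts (conf_swap cf') _ _ ra3 _ (w := w).
    rewrite size_rev mem_rev ore_sym !revK => /(_ b2_0 o_l' rb w_in).
    by case.
  have := blob_facts cf' _ _ rb3 _ (w := w).
  by rewrite size_rev mem_rev !revK => /(_ a2_0 o_l' ra w_in) [].
case=> x [y [xa yb neq_xy]]; rewrite /big_pair => big1.
case=> x2 [y2 [xa2 yb2 neq_xy2]]; rewrite /big_pair => big2.
move: xa yb xa2 yb2; rewrite !inE !mem_rev.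
have clash (p q r t : G) : deg p + deg r < #|G| -> deg q + deg t < #|G| ->
   #|G| <= deg p + deg q -> #|G| <= deg r + deg t -> False by clear; lia.
have clash' (p q r t : G) : deg p + deg t < #|G| -> deg q + deg r < #|G| ->
   #|G| <= deg p + deg q -> #|G| <= deg r + deg t -> False by clear; lia.
have su w : w \in a3 \/ w \in b3 -> deg u + deg w < #|G|.
  by move/fu/far_sum.
have sv w : w \in a1 \/ w \in b1 -> deg w + deg v < #|G|.
  by rewrite addnC => -[/fa|/fb] [/far_sum].
have sa w w' : w \in a1 -> w' \in b3 -> deg w + deg w' < #|G|.
  by move/fa=> [_ f _] /f/far_sum.
have sb w w' : w \in b1 -> w' \in a3 -> deg w + deg w' < #|G|.
  by move/fb=> [_ f _] /f/far_sum.
(* Pair [x] with [y2] and [y] with [x2], across the arcs. This fails only where it would pair [u]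
   with [v]; there, pair [x] with [x2] and [y] with [y2]. *)
case/orP=> [/eqP xu | xa]; case/orP=> [/eqP yu | yb];
  case/orP=> [/eqP xv | xa3]; case/orP=> [/eqP yv | yb3]; subst;
  rewrite ?eqxx // in neq_xy neq_xy2 *;
  try by apply: (clash' _ _ _ _ _ _ big1 big2); auto.
all: apply: (clash _ _ _ _ _ _ big1 big2); auto.
Qed.

Lemma conf_cat_path u v a b z a1 a2 :
  conf u v a b z -> a = a1 ++ a2 -> path (@adj G) u a1.
Proof. by move/conf_a=> p_a def_a; move: p_a; rewrite def_a rcons_cat cat_path => /andP[]. Qed.

(* Unless u and v are adjacent with z a single vertex, some z2 can serve as the end
   of a pendant path u, z1, z2. *)
Definition tail_ok u v z := exists (z1 : G) (z' : seq G), z = z1 :: z' /\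
  ((exists z2 : G, [/\ adj z1 z2, far z2 u & z2 = v \/ z2 \in z]) \/ z' = [::] /\ adj u v).

(** When growth is blocked at [e] and [f], the prefixes with these vertices are two arms at [u]
    without heavy cross pairs, each ending away from the other. One arm is light, and the first
    vertex of [z] completes the situation of [no_three_exits]. *)
Lemma blob_step u v a1 e a2 a3 b1 f b2 b3 z :
  let a := rcons a1 e ++ a2 ++ a3 in let b := rcons b1 f ++ b2 ++ b3 in
  conf u v a b z -> 0 < size a1 -> 0 < size b1 -> 0 < size a3 -> 0 < size b3 ->
  ore (head v a) (head v b) -> ore (last u a) (last u b) ->
  claws_heavy G -> nets_heavy G \/ woundeds_heavy G /\ tail_ok u v z ->
  blob u a1 b1 -> blob v (rev a3) (rev b3) -> ~ event u a1 b1 ->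
  [\/ (exists2 w, w \in u :: b1 & ore e w), (exists2 w, w \in u :: a1 & ore f w)
    | ore e f].
Proof.
move=> a b cf a1_0 b1_0 a3_0 b3_0 o_h o_l claw pats [ra rb] [ra3 rb3] nev.
case: (boolP (has (ore e) (u :: b1))) => [/hasP[w w_in o]|/hasPn ne].
  by constructor 1; exists w.
case: (boolP (has (ore f) (u :: a1))) => [/hasP[w w_in o]|/hasPn nf].
  by constructor 2; exists w.
case: (boolP (ore e f)) => [|nef]; [by constructor 3 | exfalso].
pose A := rcons a1 e; pose B := rcons b1 f.
have def_a : a = A ++ (a2 ++ a3) by [].
have def_b : b = B ++ (b2 ++ b3) by [].
have def_a' : a = a1 ++ (e :: a2 ++ a3) by rewrite def_a cat_rcons.
have def_b' : b = b1 ++ (f :: b2 ++ b3) by rewrite def_b cat_rcons.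
have cf' := conf_swap cf.
have o_l' : ore (last u b) (last u a) by rewrite ore_sym.
have pA := conf_cat_path cf def_a; have pB := conf_cat_path cf' def_b.
have U : uniq (u :: A ++ B).
  apply: (@subseq_uniq _ _ (u :: a ++ b)).
    by rewrite /= eqxx def_a def_b cat_subseq // prefix_subseq.
  have := conf_uniq cf; rewrite (perm_uniq (_ : perm_eq _ ((u :: a ++ b) ++ v :: z))).
    by rewrite cat_uniq => /andP[].
  by count_perm.
have z_AB w t : w \in A ++ B -> t \in z -> far t w.
  rewrite mem_cat => /orP[]; first exact: (blob_z_far cf def_a def_b' rb).
  exact: (blob_z_far cf' def_b def_a' ra).
have v_AB w : w \in A ++ B -> far v w.
  rewrite mem_cat => /orP[]; first exact: (blob_end_far cf def_a def_b' rb).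
  exact: (blob_end_far cf' def_b def_a' ra).
(* A heavy cross pair is an Ore-edge: within the old prefixes it would be an event, and with [e] or
   [f] it would allow growth. *)
have cross x y : x \in u :: A -> y \in u :: B -> x != y -> ~~ big_pair x y.
  move=> xA yB neq; apply/negP=> bxy; have oxy : ore x y by rewrite /ore neq bxy orbT.
  move: xA yB; rewrite !inE !mem_rcons !inE !orbA [(x == u) || _]orbC [(y == u) || _]orbC.
  rewrite -!orbA => /orP[/eqP xe | xa] /orP[/eqP ye | yb].
  - by rewrite -xe -ye oxy in nef.
  - by subst x; have := ne y; rewrite inE yb oxy => /(_ isT).
  - by subst y; have := nf x; rewrite inE xa ore_sym oxy => /(_ isT).
  by apply: nev; exists x, y; rewrite !inE.
have e_B y : y \in u :: B -> ~~ adj e y.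
  rewrite inE mem_rcons inE orbCA => /orP[/eqP-> | y_in].
    by apply: contra nef; apply: adj_ore.
  by apply: contra (ne y y_in); apply: adj_ore.
have f_A y : y \in u :: A -> ~~ adj f y.
  rewrite inE mem_rcons inE orbCA => /orP[/eqP-> | y_in].
    by apply: contra nef; rewrite adj_sym; apply: adj_ore.
  by apply: contra (nf y y_in); apply: adj_ore.
have [z1 [z' def_z]] : exists (z1 : G) z', z = z1 :: z'.
  by have := conf_z0 cf; case: (z) => // z1 z' _; exists z1, z'.
have uz1 : adj u z1 by have := conf_z cf; rewrite def_z => /andP[].
have z1_far w : w \in A ++ B -> far z1 w.
  by move/z_AB; apply; rewrite def_z inE eqxx.
have A0 : exists x A', A = x :: A'.
  by rewrite /A; case: (a1) a1_0 => // x s _; exists x, (rcons s e).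
have B0 : exists x B', B = x :: B'.
  by rewrite /B; case: (b1) b1_0 => // x s _; exists x, (rcons s f).
have lastA : last u A = e by rewrite last_rcons.
have lastB : last u B = f by rewrite last_rcons.
have [x0 [A' def_A]] := A0; have [y0 [B' def_B]] := B0.
have pats' : nets_heavy G \/ woundeds_heavy G /\ tail_witness z1 u (A ++ B).
  case: pats => [|[wnd [z1' [z'' [def_z'' tl]]]]]; [by left | right; split=> //].
  move: def_z'' tl; rewrite def_z => -[<- <-] [[z2 [z12 z2u z2v]] | [z'0 uv]].
    exists z2; split=> // w w_in; case: z2v => [-> | z2z]; first exact: v_AB.
    by apply: z_AB; rewrite ?def_z.
  (* Now [v, u, z1] is a triangle. The last vertex [y] of [b] hangs on [v], and an edge [x x'] of
     the arm along which adjacency to [u] is lost gives a pendant path at [u]: a light wounded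
     graph. *)
  exfalso; subst z'.
  have [s1 [x' [s2 [def_A' xx' ux ux']]]] : exists s1 y s2,
    [/\ A' = s1 ++ y :: s2, adj (last x0 s1) y, adj u (last x0 s1) & ~~ adj u y].
    apply: path_threshold; move: pA; rewrite def_A => /andP[] //.
    move=> _ _; have := e_B u; rewrite inE eqxx adj_sym => /(_ isT).
    by rewrite -lastA def_A.
  set x := last x0 s1 in xx' ux.
  have xA : x \in A by rewrite def_A def_A' -cat_cons mem_cat mem_last.
  have x'A : x' \in A by rewrite def_A def_A' inE mem_cat inE eqxx !orbT.
  have inAB w : w \in A -> w \in A ++ B by rewrite mem_cat => ->.
  have [y [b4 def_b3]] : exists y b4, b3 = rcons b4 y.
    by case/lastP: (b3) b3_0 => // s y _; exists y, s.
  have y_b3 : y \in b3 by rewrite def_b3 mem_rcons inE eqxx.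
  have vy : adj v y.
    have := conf_b cf; rewrite rcons_path => /andP[_].
    by rewrite /b def_b3 !last_cat last_rcons adj_sym.
  have vz1 : adj v z1 by have := conf_z cf; rewrite def_z /= [adj z1 v]adj_sym => /and3P[].
  have y_far w : w \in A -> far y w.
    rewrite far_sym => w_in.
    exact: (blob_no_chord cf def_a def_b' rb erefl (erefl : _ = (f :: b2) ++ b3)).
  have cfr : conf v u (rev b3 ++ rev (f :: b2) ++ rev b1)
                      (rev a3 ++ rev (e :: a2) ++ rev a1) (rev z).
    by have := conf_rev cf'; rewrite def_a' def_b' -!cat_cons !rev_cat -!catA.
  have [uy _ zy] : [/\ far u y, forall w, w \in rev a1 -> far y w
                     & forall t, t \in rev z -> far t y].
    apply: (blob_facts cfr); rewrite ?size_rev ?revK ?mem_rev //.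
    by rewrite -!rev_cat !last_rev ore_sym -!catA -def_a' -def_b'.
  have ux'_far : far u x'.
    rewrite farE ux' andbC eq_sym; have neq : x' != u.
      by apply: contraTneq x'A => ->; move: U; rewrite /= mem_cat => /andP[/norP[]].
    by rewrite neq andbT big_pair_sym cross ?inE ?x'A ?eqxx ?orbT.
  apply: (wnd v u z1 y x x') => //; try exact: y_far; try exact: z1_far (inAB _ _);
    try exact: v_AB (inAB _ _).
    by rewrite adj_sym.
  by rewrite zy // mem_rev def_z inE.
(* A heavy pair inside an arm contains a vertex of degree at least half the order; two such vertices
   in different arms would be a heavy cross pair. *)
have light_half C D :
  (forall x y, x \in u :: C -> y \in u :: D -> x != y -> ~~ big_pair x y) ->
  uniq (u :: C ++ D) ->
  ~~ has (fun x => big_pair x x) C || ~~ has (fun x => big_pair x x) D.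
  move=> cr UCD; apply/norP=> -[]; rewrite !negbK => /hasP[x xC bx] /hasP[y yD big_y].
  have := cr x y; rewrite !inE xC yD !orbT => /(_ isT isT).
  rewrite (@uniq_neq _ C D) //; last by move: UCD => /= /andP[].
  by move=> /(_ isT) /negP[]; move: bx big_y; rewrite /big_pair; clear; lia.
have light C x y : ~~ has (fun x => big_pair x x) C -> x \in C -> y \in C -> ~~ big_pair x y.
  move=> /hasPn lC /lC bx /lC; move: bx; rewrite /big_pair; clear; lia.
case/orP: (light_half _ _ cross U) => lt.
  apply: (@no_three_exits G u z1 y0 B' A) => //; rewrite -?def_B //.
  - by rewrite (perm_uniq (_ : perm_eq _ (u :: A ++ B))) //; count_perm.
  - by move=> w; rewrite mem_cat orbC -mem_cat; apply: z1_far.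
  - by move=> x y xB yA neq; rewrite big_pair_sym cross // eq_sym.
  - by move=> x y; apply: light.
  - move=> y y_in; have -> : last y0 B' = f by rewrite -lastB def_B.
    exact: f_A.
  - by rewrite def_A.
  - by rewrite lastA.
  case: pats' => [|[wnd [z2 [? ? z2_far]]]]; [by left | right; split=> //].
  by exists z2; split=> // w; rewrite mem_cat orbC -mem_cat; apply: z2_far.
apply: (@no_three_exits G u z1 x0 A' B) => //; rewrite -?def_A //.
- by move=> x y; apply: light.
- move=> y y_in; have -> : last x0 A' = e by rewrite -lastA def_A.
  exact: e_B.
- by rewrite def_B.
- by rewrite lastB.
Qed.

End Blobs.

(** * Ears of a longest cycle *)

Section Tail.

Variable G : sgraph.
Implicit Types (x y u v w : G) (s W : seq G).
Local Notation ore := (@ore G).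
Local Notation far := (@far G).
Local Notation big_pair := (@big_pair G).

(* Replace the segment s2 of the Ore-cycle L by the Ore-path x0 :: P. *)
Lemma insertion m L x0 P s1 x s2 y s3 :
  (forall c, uniq c -> cycle ore c -> size c <= m) ->
  cycle ore L -> uniq (L ++ x0 :: P) -> L = s1 ++ x :: s2 ++ y :: s3 ->
  path ore x0 P -> ore x x0 -> ore (last x0 P) y ->
  size L + (size P).+1 <= m + size s2.
Proof.
move=> c_max cL U def_L oP ox oy.
have rot_L : cycle ore (y :: s3 ++ rcons s1 x ++ s2).
  have := rot_cycle (size (rcons s1 x ++ s2)) ore L.
  by rewrite cL def_L -cat_rcons catA rot_size_cat.
have := c_max (y :: s3 ++ rcons s1 x ++ x0 :: P).
have -> : uniq (y :: s3 ++ rcons s1 x ++ x0 :: P).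
  move: U; rewrite def_L (perm_uniq
    (_ : perm_eq _ (s2 ++ (y :: s3 ++ rcons s1 x ++ x0 :: P)))).
    by rewrite cat_uniq => /and3P[].
  by count_perm.
have -> : cycle ore (y :: s3 ++ rcons s1 x ++ x0 :: P).
  move: rot_L; rewrite /= !rcons_path !cat_path !last_cat last_rcons /=.
  by case/andP=> /and3P[-> -> _] _; rewrite ox oP oy.
move/(_ isT isT); rewrite def_L /= !size_cat size_rcons /= size_cat /=.
by clear; lia.
Qed.

Lemma ore_clique_path x W t :
  uniq W -> {in W &, forall w w', w != w' -> ore w w'} ->
  (forall w, w \in W -> ore x w) -> (forall w, w \in W -> ore w t) ->
  0 < size W -> path ore x (rcons W t).
Proof.
elim: W x => // w [|w' W] IHW x U cl ox ot _.
  by rewrite /= ox ?ot ?inE ?eqxx.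
rewrite /= ox ?inE ?eqxx //=; apply: IHW => //.
- by case/andP: U.
- by move=> y y' yW y'W; apply: cl; rewrite inE ?yW ?y'W orbT.
- move=> y yW; apply: cl; rewrite 1?in_cons ?eqxx ?yW ?orbT //.
  by case/andP: U => wW _; apply: contraNneq wW => ->.
by move=> y yW; apply: ot; rewrite inE yW orbT.
Qed.

(** Minimality of [z] among all ears of the cycle, whatever their ends. *)
Definition short u v (a b z : seq G) := forall x y s,
  x \in u :: v :: a ++ b -> y \in u :: v :: a ++ b -> x != y -> 0 < size s ->
  uniq s ->
  (forall w, w \in s -> w \notin u :: v :: a ++ b) ->
  path (@adj G) x (rcons s y) -> size z <= size s.

Lemma short_rev u v a b z : short u v a b z -> short v u (rev a) (rev b) (rev z).
Proof.
have inC w : (w \in v :: u :: rev a ++ rev b) = (w \in u :: v :: a ++ b).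
  by rewrite !inE !mem_cat !mem_rev orbCA.
move=> sh x y s; rewrite !inC size_rev => xC yC neq s0 Us dis.
by apply: sh => // w /dis; rewrite inC.
Qed.

(** * The pendant path along a shortest ear *)

Section Config.

Variables (u v x1 y1 : G) (a a' b b' z : seq G).
Hypotheses (def_a : a = x1 :: a') (def_b : b = y1 :: b').
Hypotheses (cf : conf u v a b z) (sh : short u v a b z) (claw : claws_heavy G).
Hypotheses (o_h : ore x1 y1) (o_l : ore (last u a) (last u b)).

Local Notation C := (u :: v :: a ++ b).

Lemma C_uniq : uniq C.
Proof.
have := conf_uniq cf; rewrite (perm_uniq (_ : perm_eq _ (C ++ z))).
  by rewrite cat_uniq => /and3P[].
by count_perm.
Qed.

(** Otherwise [w] could be inserted between [u] and [x1]. *)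
Lemma out_far w : adj u w -> w \notin C -> far w x1.
Proof.
move=> uw wC; rewrite /far; apply/andP; split.
  by apply: contraNneq wC => ->; rewrite !inE def_a mem_cat inE eqxx !orbT.
apply/negP => o_w; have := conf_max cf (c := w :: (a ++ v :: rcons (rev b) u)).
have perm_c : perm_eq (w :: (a ++ v :: rcons (rev b) u)) (w :: C) by count_perm.
rewrite (perm_uniq perm_c) (perm_size perm_c) cons_uniq wC C_uniq => /(_ isT).
suff -> : cycle ore (w :: (a ++ v :: rcons (rev b) u)).
  by move=> /(_ isT); rewrite /= !size_cat /=; clear; lia.
have /path_back_rcons o_b := ore_b cf; have := ore_a cf.
rewrite rcons_path def_a /= => /andP[/andP[_ o_a] o_av].
rewrite o_w rcons_path cat_path o_a /= o_av o_b last_cat /= last_rcons.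
exact: adj_ore.
Qed.

(** Two of these vertices that are not Ore-adjacent would form a light claw at [u] together with
    [x1]. *)
Lemma common_out_clique t : let W := enum (out_nbrs C u :&: out_nbrs C t) in
  {in W &, forall w w', w != w' -> ore w w'}.
Proof.
move=> W w w'; rewrite !mem_enum !inE => /andP[/andP[uw wC] _] /andP[/andP[uw' w'C] _] neq.
apply/idPn=> no; apply: (claw (c := u) (x := w) (y := w') (w := x1)) => //.
- by have := conf_a cf; rewrite def_a => /andP[].
- by rewrite /far neq.
- exact: out_far.
exact: out_far.
Qed.

Lemma count_C (P : pred G) : count P C = P u + P v + count P a + count P b.
Proof. by rewrite /= count_cat !addnA. Qed.

Lemma card_C : (size a + size b).+2 <= #|G|.
Proof.
by rewrite -size_cat -[_.+2]/(size C) -(card_uniqP C_uniq) max_card.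
Qed.

(** Adjacency would give a shorter ear. A heavy pair is excluded by counting: the common outside
    neighbours of [u] and [z2], followed by the rest of [z], form an Ore-path [P]; inserting it
    shows that [u] misses at least [size P] vertices of the cycle, while [z2] sees at most [v]
    there. *)
Lemma tail_long (z1 z2 : G) z' : z = z1 :: z2 :: z' -> far z2 u.
Proof.
move=> def_z; have := conf_z cf; rewrite def_z /= => /and3P[uz1 z12 p_z].
have z_out w : w \in z -> w \notin C.
  move=> wz; apply/negP=> wC; have := conf_uniq cf.
  rewrite (perm_uniq (_ : perm_eq _ (C ++ z))); last by count_perm.
  by rewrite cat_uniq => /and3P[_ /hasPn/(_ _ wz)/negP].
(* A later vertex of [z] with a neighbour on the cycle other than [v] would start a shorter ear to
   [v]. *)
have far_C s1 w s2 x : z = s1 ++ w :: s2 -> 0 < size s1 -> x \in C -> adj x w -> x = v.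
  move=> def_z' s1_0 xC xw; apply/eqP/idPn=> neq.
  have := sh (x := x) (y := v) (s := w :: s2) xC _ neq isT.
  rewrite in_cons in_cons eqxx orbT => /(_ isT) H; have: size z <= (size s2).+1.
    apply: H => [|t tz | /=].
      have := conf_uniq cf; rewrite !cons_uniq !cat_uniq def_z'.
      by case/and3P=> _ _ /and3P[_ _ /and3P[_ _]]; rewrite cat_uniq => /and3P[].
      by apply: z_out; rewrite def_z' mem_cat tz orbT.
    rewrite xw; have := conf_z cf; rewrite def_z' rcons_cat cat_path /=.
    by case/and3P.
  by rewrite def_z' size_cat /=; move: s1_0; clear; lia.
have uC : u \in C by rewrite inE eqxx.
have neq_uv : u != v.
  by have := C_uniq; rewrite /= !inE negb_or -andbA => /andP[].
have nu s1 w s2 : z = s1 ++ w :: s2 -> 0 < size s1 -> ~~ adj u w.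
  by move=> dz s0; apply/negP => /(far_C _ _ _ _ dz s0 uC)/eqP; apply/negP.
have z2z : z2 \in z by rewrite def_z !inE eqxx orbT.
have nadj : ~~ adj u z2 by apply: (nu [:: z1] z2 z').
rewrite far_sym farE nadj; apply/andP; split.
  by apply: contraTneq (z_out _ z2z) => <-; rewrite uC.
apply/negP; rewrite /big_pair => big_uz.
set D := z2 :: C.
have D_uniq : uniq D by rewrite cons_uniq z_out ?C_uniq.
pose W := enum (out_nbrs D u :&: out_nbrs D z2).
have W_in w : w \in W -> [/\ adj u w, adj z2 w, w != z2 & w \notin C].
  by rewrite mem_enum in_setI !in_set in_cons negb_or => /andP[/and3P[-> -> ->] /andP[->]].
have z1W : z1 \in W.
  rewrite mem_enum in_setI !in_set uz1 [adj z2 z1]adj_sym z12 in_cons negb_or.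
  by rewrite adj_neq // z_out // def_z inE eqxx.
have W0 : 0 < size W by case: (W) z1W.
have Wcl : {in W &, forall w w', w != w' -> ore w w'}.
  move=> w w' /W_in[uw _ _ wC] /W_in[uw' _ _ w'C] neq.
  by apply: (@common_out_clique u) => //; rewrite mem_enum in_setI !in_set ?uw ?uw' andbb //=.
have o_uW : path ore u (rcons W z2).
  apply: ore_clique_path; rewrite ?enum_uniq //.
    by move=> w /W_in[/adj_ore].
  by move=> w /W_in[_ zw _ _]; rewrite ore_sym adj_ore.
pose P := W ++ z2 :: z'.
have o_P : path ore u (rcons P v).
  rewrite /P -cat_rcons rcons_cat cat_path o_uW last_rcons.
  exact: path_ore.
have [s1 [y [s2 [def_rb ns1 uy]]]] : exists s1 y s2,
    [/\ rev b = s1 ++ y :: s2, ~~ has (adj u) s1 & adj u y].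
  have hb : has (adj u) (rev b).
    rewrite has_rev; apply/hasP; exists y1; first by rewrite def_b inE eqxx.
    by have := conf_b cf; rewrite def_b => /andP[].
  move: (rev b) hb => r /split_find [y r1 r2 uy nr]; exists r1, y, r2.
  by rewrite cat_rcons.
have U_z : uniq z.
  have := conf_uniq cf; rewrite !cons_uniq !cat_uniq.
  by case/and3P=> _ _ /and3P[_ _ /and3P[]].
have U_P : uniq (C ++ P).
  rewrite cat_uniq C_uniq /= /P cat_uniq enum_uniq /=; apply/and3P; split.
  - apply/hasPn=> w; rewrite mem_cat => /orP[/W_in[] // | wz].
    by apply: z_out; rewrite def_z inE wz orbT.
  - apply/norP; split; first by apply/negP=> /W_in[_ _ /eqP].
    apply/hasPn=> w wz'; apply/negP=> /W_in[uw _ _ _].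
    have [t1 [t2 def_z']] := in_split wz'.
    suff /negP[] : ~~ adj u w by [].
    by apply: (nu [:: z1, z2 & t1] w t2); rewrite // def_z def_z'.
  by move: U_z; rewrite def_z => /andP[].
(* The cycle skips [u] by the Ore-edge between its two neighbours; this frees [u], which then joins
   the end of [rev P] to its neighbour [y]. *)
have cyc : cycle ore (v :: rev b ++ a).
  rewrite /= rcons_path cat_path (path_back (ore_b cf)) last_rev last_cat /=.
  have := ore_a cf; rewrite rcons_path => /andP[].
  by rewrite def_a def_b /= => /andP[_ ->] ->; rewrite [ore y1 x1]ore_sym o_h.
have sP : size P <= size s1.
  have := path_back_rcons o_P; have : size (rev P) = size P by rewrite size_rev.
  case def_P: (rev P) => [|x0 P'] sP; first by rewrite -sP.
  rewrite rcons_cons => /andP[o1 o2].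
  have U_ins : uniq ((v :: rev b ++ a) ++ x0 :: rcons P' u).
    move: U_P; rewrite (perm_uniq (_ : perm_eq _ ((v :: rev b ++ a) ++ rcons (rev P) u))) //.
      by rewrite def_P.
    by count_perm.
  have def_L : v :: rev b ++ a = [::] ++ v :: s1 ++ y :: s2 ++ a.
    by rewrite def_rb -catA.
  have oy : ore (last x0 (rcons P' u)) y by rewrite last_rcons adj_ore.
  have := insertion (conf_max cf) cyc U_ins def_L o2 o1 oy.
  rewrite -sP /= size_cat size_rev size_rcons; clear; lia.
have cu : count (adj u) C + size s1 <= (size a + size b).+1.
  rewrite count_C adj_irrefl add0n -(count_rev _ b) def_rb count_cat -(size_rev b) def_rb size_cat.
  move: ns1; rewrite has_count -leqNgt leqn0 => /eqP ->.
  have := count_size (adj u) a; have := count_size (adj u) (y :: s2).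
  by case: (adj u v); clear; lia.
have cz : count (adj z2) C <= 1.
  rewrite -size_filter; apply: (@uniq_leq_size _ _ [:: v]).
    exact: filter_uniq C_uniq.
  move=> w; rewrite mem_filter => /andP[zw wC]; rewrite inE; apply/eqP.
  by apply: (far_C [:: z1] z2 z'); rewrite // adj_sym.
have := card_out_nbrs2 u z2 D_uniq; rewrite [#|_ :&: _|]cardE -/W.
have duD : deg u = count (adj u) C + #|out_nbrs D u|.
  by rewrite (deg_out u D_uniq) -[count _ D]/(adj u z2 + count (adj u) C) (negPf nadj).
have dzD : deg z2 = count (adj z2) C + #|out_nbrs D z2|.
  by rewrite (deg_out z2 D_uniq) -[count _ D]/(adj z2 z2 + count (adj z2) C) adj_irrefl.
have sW : size P = size W + (size z').+1 by rewrite size_cat.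
have sD : size D = (size a + size b).+3 by rewrite /= size_cat.
have sDn : size D <= #|G| by rewrite -(card_uniqP D_uniq) max_card.
move: big_uz; rewrite duD dzD; move: sP cu cz sW sDn; rewrite sD; clear.
move: (size W) (size P) (size z') (size s1) (size a) (size b) #|out_nbrs D u|
  #|out_nbrs D z2| (count (adj u) C) (count (adj z2) C) #|G|; clear; lia.
Qed.

(** Suppose the pair is heavy. Skipping [u] and [v] leaves an Ore-cycle [L], into which the path
    [u, W, v] through their common outside neighbours can be inserted. So on [L] at least [size W]
    vertices separate a neighbour of [u] from a later neighbour of [v], which bounds the degree sum
    below the order. *)
Lemma tail_short z1 : z = [:: z1] -> ~~ adj u v -> far v u.
Proof.
move=> def_z nadj.
have vu : v != u by have := C_uniq; rewrite /= !inE eq_sym negb_or -andbA => /andP[].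
rewrite farE vu adj_sym nadj; apply/negP; rewrite big_pair_sym /big_pair => big_uv.
have := conf_z cf; rewrite def_z /= [adj z1 v]adj_sym => /and3P[uz1 vz1 _].
have z1C : z1 \notin C.
  apply/negP=> wC; have := conf_uniq cf; rewrite def_z.
  rewrite (perm_uniq (_ : perm_eq _ (z1 :: C))); last by count_perm.
  by rewrite cons_uniq wC.
set L := a ++ rev b.
have cyc : cycle ore L.
  have [a0 o_ll] : exists x, x = last u b by exists (last u b).
  rewrite /L def_a def_b /= rcons_path cat_path.
  have := ore_a cf; rewrite def_a rcons_path /= => /andP[/andP[_ ->] _].
  have := path_back (ore_b cf); rewrite def_b => o_b.
  rewrite last_cat last_rev /= [ore y1 x1]ore_sym o_h andbT /=.
  have := o_l; rewrite def_a def_b /=.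
  move: o_b; rewrite (lastI y1 b') rev_rcons /= => /andP[_ ->] ->.
  by [].
pose W := enum (out_nbrs C u :&: out_nbrs C v).
have W_in w : w \in W -> [/\ adj u w, adj v w & w \notin C].
  by rewrite mem_enum in_setI !in_set => /andP[/andP[-> ->] /andP[->]].
have z1W : z1 \in W by rewrite mem_enum in_setI !in_set uz1 vz1 z1C.
have W0 : 0 < size W by case: (W) z1W.
have Wcl : {in W &, forall w w', w != w' -> ore w w'} by apply: common_out_clique.
have o_uW : path ore u (rcons W v).
  apply: ore_clique_path; rewrite ?enum_uniq //.
    by move=> w /W_in[/adj_ore].
  by move=> w /W_in[_ vw _]; rewrite ore_sym adj_ore.
have ins s1 x s2 y s3 : L = s1 ++ x :: s2 ++ y :: s3 -> adj u x -> adj v y ->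
    size W <= size s2.
  move=> def_L ux vy.
  have U_ins : uniq (L ++ u :: rcons W v).
    rewrite (perm_uniq (_ : perm_eq _ (C ++ W))); last by rewrite /L; count_perm.
    rewrite cat_uniq C_uniq enum_uniq andbT; apply/hasPn=> w.
    by case/W_in.
  have := insertion (conf_max cf) cyc U_ins def_L o_uW.
  rewrite ore_sym adj_ore // last_rcons adj_ore // => /(_ isT isT).
  by rewrite size_cat size_rev size_rcons; clear; lia.
(* Here the blob is empty and [x1] is the vertex just beyond it. *)
have nv1 : ~~ adj v x1.
  have r0 : reach u [::] [::] by case=> // b0 _; apply: link_refl.
  by rewrite (far_nadj (blob_end_far (a1 := [::]) (e := x1) (a' := a') (b1 := [::])
       (b' := b) cf def_a erefl r0 o_l (mem_head _ _))).
have [L1 [y [L2 [def_L nL1 vy]]]] : exists s1 y s2,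
    [/\ L = s1 ++ y :: s2, ~~ has (adj v) s1 & adj v y].
  have hL : has (adj v) L.
    have := conf_a cf; rewrite rcons_path def_a => /andP[_ vl].
    apply/hasP; exists (last x1 a'); last by rewrite adj_sym.
    by rewrite mem_cat def_a mem_last.
  move: (L) hL => r /split_find [y r1 r2 vy nr]; exists r1, y, r2.
  by rewrite cat_rcons.
(* Let [t] be the last neighbour of [u] in [L1]; one exists because [L1] starts with [x1]. At least
   [size W] vertices lie between [t] and [y]. *)
have cnt1 : count (adj u) L1 + size W <= size L1.
  case: L1 def_L nL1 => [|x L1] def_L nL1.
    by move: def_L nv1; rewrite /L def_a => -[-> _]; rewrite vy.
  have ux1 : adj u x.
    by move: def_L; rewrite /L def_a => -[<- _]; have := conf_a cf; rewrite def_a => /andP[].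
  have hr : has (adj u) (rev (x :: L1)) by rewrite has_rev /= ux1.
  have sz : size (rev (x :: L1)) = size (x :: L1) by rewrite size_rev.
  rewrite -count_rev -sz; move: (erefl (rev (x :: L1))) hr.
  move: {1 3 4 5}(rev _) => r def_r /split_find def_s; case: def_s def_r => t r1 r2 ut nr def_r.
  have def_L1 : x :: L1 = rev r2 ++ t :: rev r1.
    by rewrite -[x :: L1]revK -def_r rev_cat rev_rcons.
  have := ins (rev r2) t (rev r1) y L2; rewrite def_L def_L1 -catA => /(_ erefl ut vy).
  move: nr; rewrite has_count -leqNgt leqn0 size_rev count_cat -cats1 count_cat /= => /eqP->.
  rewrite !size_cat /= ut; have := count_size (adj u) r2; clear; lia.
have cnt2 : count (adj v) L2 + count (adj u) (belast y L2) <= size L2.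
  apply: count_no_consecutive => p1 t p2 def_L2; apply/negP=> /andP[ut vt].
  have [s1 def_s] : exists s1, L = s1 ++ last y p1 :: [::] ++ t :: p2.
    exists (L1 ++ belast y p1).
    rewrite def_L def_L2 -catA; congr (_ ++ _).
    by rewrite /= -(cat_rcons (last y p1)) -lastI.
  by have := ins _ _ _ _ _ def_s ut vt; rewrite leqNgt W0.
have cL t : count (adj t) C = adj t u + adj t v + count (adj t) L.
  by rewrite count_C /L count_cat count_rev !addnA.
have du : deg u = count (adj u) L + #|out_nbrs C u|.
  by rewrite (deg_out u C_uniq) cL adj_irrefl (negPf nadj).
have dv : deg v = count (adj v) L + #|out_nbrs C v|.
  by rewrite (deg_out v C_uniq) cL adj_irrefl adj_sym (negPf nadj).
have cuL : count (adj u) L <= count (adj u) L1 + count (adj u) (belast y L2) + 1.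
  rewrite def_L count_cat lastI -cats1 count_cat /= -addnA leq_add2l leq_add2l addn0.
  by case: adj.
have cvL : count (adj v) L = (count (adj v) L2).+1.
  move: nL1; rewrite has_count -leqNgt leqn0 def_L count_cat => /eqP->.
  by rewrite /= vy.
have := card_out_nbrs2 u v C_uniq; rewrite [#|_ :&: _|]cardE -/W.
have sC : size C = (size a + size b).+2 by rewrite /= size_cat.
have sL : size a + size b = size L1 + (size L2).+1.
  by rewrite -(size_rev b) -size_cat -/L def_L size_cat.
have := card_C; rewrite sC sL.
move: big_uv cnt1 cnt2 cuL; rewrite du dv cvL; clear.
move: (size W) (size L1) (size L2) #|out_nbrs C u| #|out_nbrs C v| (count (adj u) L)
  (count (adj v) L2) (count (adj u) L1) (count (adj u) (belast y L2)) #|G|; clear; lia.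
Qed.

Lemma tail_okP : tail_ok u v z.
Proof.
have := conf_z0 cf; case def_z: z => [//|z1 z'] _; exists z1, z'; split=> //.
have := conf_z cf; rewrite def_z /= => /andP[uz1].
case: z' def_z => [|z2 z'] def_z /=; last first.
  case/andP=> z12 _; left; exists z2; split=> //; first exact: tail_long def_z.
  by right; rewrite !inE eqxx orbT.
case/andP=> z1v _; case uv: (adj u v); [by right | left].
exists v; split=> //; last by left.
by apply: tail_short def_z _; rewrite uv.
Qed.

End Config.
End Tail.

(** * Growing blobs from both ends of the ear *)

Section Final.

Variable G : sgraph.
Implicit Types (x y u v w e f : G) (s a b z : seq G).
Local Notation ore := (@ore G).
Local Notation far := (@far G).

Hypothesis claw : claws_heavy G.
Hypothesis pats : nets_heavy G \/ woundeds_heavy G.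

Lemma ore_a_prefix u v a b z a1 e a2 :
  conf u v a b z -> a = a1 ++ e :: a2 -> path ore u (rcons a1 e).
Proof.
by move/ore_a=> o_a def_a; move: o_a; rewrite def_a -cat_rcons rcons_cat cat_path => /andP[].
Qed.

Lemma blob_mid u v a1 a2 a3 b1 b2 b3 z :
  conf u v (a1 ++ a2 ++ a3) (b1 ++ b2 ++ b3) z ->
  blob u a1 b1 -> blob v (rev a3) (rev b3) -> 0 < size a2 /\ 0 < size b2.
Proof.
move=> cf [ra rb] [ra3 rb3].
have lk c d w : reach w (rev c) (rev d) -> link w (head w c) (w :: c ++ d).
  move/(_ (rev d) [::]); rewrite cats0 last_rev => /(_ erefl).
  by apply: link_perm; count_perm.
have lk1 c d : reach u c d -> link u (last u c) (u :: c ++ d).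
  by move/(_ d [::]); rewrite cats0; apply.
split; rewrite lt0n; apply/eqP=> /size0nil def2; subst.
  exact: (no_touch cf erefl erefl (lk1 _ _ rb) (lk _ _ _ rb3)).
exact: (no_touch (conf_swap cf) erefl erefl (lk1 _ _ ra) (lk _ _ _ ra3)).
Qed.

(** Induction on the size of the two gaps. Without an event, [blob_step] enlarges the blob; by
    [blob_mid] the gaps never vanish, so growth can only end with an event. *)
Lemma blob_event u v a1 a2 a3 b1 b2 b3 z :
  let a := a1 ++ a2 ++ a3 in let b := b1 ++ b2 ++ b3 in
  conf u v a b z -> ore (head u a) (head u b) -> ore (head v a) (head v b) ->
  ore (last u a) (last u b) -> tail_ok u v z ->
  0 < size a1 -> 0 < size b1 -> 0 < size a3 -> 0 < size b3 ->
  blob u a1 b1 -> blob v (rev a3) (rev b3) ->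
  exists a4 a5 b4 b5, [/\ a = a4 ++ a5 ++ a3, b = b4 ++ b5 ++ b3, blob u a4 b4
    & event u a4 b4] /\ (0 < size a4 /\ 0 < size b4).
Proof.
have [m] := ubnP (size a2 + size b2).
elim: m => // m IHm in a1 a2 b1 b2 *; 
move=> lt_m a b cf o_hu o_h o_l tl a1_0 b1_0 a3_0 b3_0 bu bv.
have [a2_0 b2_0] := blob_mid cf bu bv.
case: (boolP [exists x : G, [exists y : G,
  [&& x \in u :: a1, y \in u :: b1, x != y & big_pair x y]]]).
  case/existsP=> x /existsP[y /and4P[xa yb neq big]].
  by exists a1, a2, b1, b2; split=> //; split=> //; exists x, y.
move=> nex; have nev : ~ event u a1 b1.
  case=> x [y [xa yb neq big]]; case/negP: nex.
  by apply/existsP; exists x; apply/existsP; exists y; apply/and4P.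
case: a2 => // e a2 in lt_m a cf o_hu o_h o_l a2_0 *.
case: b2 => // f b2 in lt_m b cf o_hu o_h o_l b2_0 *.
have def_a : a = rcons a1 e ++ a2 ++ a3 by rewrite cat_rcons.
have def_b : b = rcons b1 f ++ b2 ++ b3 by rewrite cat_rcons.
have o_a : path ore u (rcons a1 e) := ore_a_prefix cf erefl.
have o_b : path ore u (rcons b1 f) := ore_a_prefix (conf_swap cf) erefl.
have step : [\/ blob u (rcons a1 e) b1, blob u a1 (rcons b1 f)
             | blob u (rcons a1 e) (rcons b1 f)].
  have o_xy : exists x a' y b', [/\ a1 = x :: a', b1 = y :: b' & ore x y].
    move: o_hu a1_0 b1_0; rewrite /a /b; case: (a1) => // x a' ; case: (b1) => // y b' o_xy.
    by exists x, a', y, b'.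
  have [x [a' [y [b' [da1 db1 o_xy']]]]] := o_xy.
  have := @blob_step G u v a1 e a2 a3 b1 f b2 b3 z.
  rewrite -def_a -def_b => /(_ cf a1_0 b1_0 a3_0 b3_0 o_h o_l claw) H.
  case: (H _ bu bv nev).
  - by case: pats => [|w]; [left | right].
  - case=> w w_in o_ew; constructor 1; move: o_a o_b bu w_in; rewrite da1 db1.
    by rewrite (rcons_path _ u (y :: b')) => oa /andP[ob _] bu w_in; apply: blob_grow o_ew.
  - case=> w w_in o_fw; constructor 2; move: o_a o_b bu w_in; rewrite da1 db1.
    rewrite (rcons_path _ u (x :: a')) => /andP[oa _] ob /blob_sym bu w_in.
    by apply: blob_sym; apply: blob_grow o_fw; rewrite // ore_sym.
  move=> oef; constructor 3; move: o_a o_b; rewrite !rcons_path => /andP[_ o1] /andP[_ o2].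
  exact: blob_grow2.
have shape4 a4 b4 a5 b5 : a = a4 ++ a5 ++ a3 -> b = b4 ++ b5 ++ b3 ->
    size a5 + size b5 < m -> 0 < size a4 -> 0 < size b4 -> blob u a4 b4 ->
  exists a4 a5 b4 b5, [/\ a = a4 ++ a5 ++ a3, b = b4 ++ b5 ++ b3, blob u a4 b4
    & event u a4 b4] /\ (0 < size a4 /\ 0 < size b4).
  move=> da db lt45 a4_0 b4_0 b45.
  have := IHm a4 a5 b4 b5 lt45; rewrite /= -da -db; exact.
move: lt_m; rewrite /= !ltnS addnS => lt_m.
case: step => bl.
- apply: (shape4 (rcons a1 e) b1 a2 (f :: b2)) => //; rewrite ?size_rcons //=.
  by rewrite addnS.
- apply: (shape4 a1 (rcons b1 f) (e :: a2) b2) => //; rewrite ?size_rcons //=.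
apply: (shape4 (rcons a1 e) (rcons b1 f) a2 b2) => //; rewrite ?size_rcons //.
exact: ltnW.
Qed.

(** Replacing an empty arc by [z] would lengthen the cycle. *)
Lemma conf_nonempty u v a b z : conf u v a b z -> 0 < size a.
Proof.
move=> cf; case: a cf => // cf; exfalso.
have lk := link_ext (link_refl u) (ore_z cf); rewrite last_rcons in lk.
have {}lk := link_ext lk (path_back (ore_b cf)); rewrite last_rev in lk.
apply: (conf_close_full cf lk); first by count_perm.
by have := ore_b cf; case: (b) => [|y b'] /= /andP[o _]; rewrite ore_sym.
Qed.

(** Consider the claw at [u] with leaves [x], [y] and the first vertex of [z]; the latter is far
    from both others by maximality of the cycle. *)
Lemma conf_ore_head u v x a b y z :
  conf u v (x :: a) (y :: b) z -> ore x y.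
Proof.
move=> cf; have := conf_z0 cf; case def_z: z => [//|z1 z'] _.
have ux : adj u x by have := conf_a cf => /andP[].
have uy : adj u y by have := conf_b cf => /andP[].
have uz : adj u z1 by have := conf_z cf; rewrite def_z => /andP[].
have r0 : reach u [::] [::] by case=> // b0 _; apply: link_refl.
have z1z : z1 \in z by rewrite def_z inE eqxx.
apply/idPn=> no; apply: (claw (c := u) (x := x) (y := y) (w := z1)) => //.
- rewrite /far no andbT; have := conf_uniq cf; rewrite !cons_uniq => /and3P[_ _].
  by rewrite /= mem_cat inE => /andP[/norP[_ /norP[]]].
- rewrite far_sym.
  exact: (@blob_z_far _ u v _ _ z cf [::] x a [::] (y :: b) erefl erefl r0 x z1
    (mem_head _ _) z1z).
rewrite far_sym.
exact: (@blob_z_far _ u v _ _ z (conf_swap cf) [::] y b [::] (x :: a) erefl erefl r0 y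
  z1 (mem_head _ _) z1z).
Qed.

(** If [x] were a whole arc, one could go from [u] through [z] to [v], back along the other arc,
    across to [x] and home. Hence each arc has distinct first and last vertices from which to start
    the blobs. *)
Lemma conf_size2 u v x a b z : conf u v (x :: a) b z -> 0 < size a.
Proof.
move=> cf; have := conf_nonempty (conf_swap cf); case: b cf => // y b cf _.
have o_xy := conf_ore_head cf; case: a cf => // cf; exfalso.
have lk := link_ext (link_refl u) (ore_z cf); rewrite last_rcons in lk.
have {}lk := link_ext lk (path_back (ore_b cf)); rewrite last_rev /= in lk.
have p_x : path ore y [:: x] by rewrite /= ore_sym o_xy.
apply: (conf_close_full cf (link_ext lk p_x)); first by count_perm.
by rewrite /= ore_sym; have := ore_a cf => /= /andP[].
Qed.

(** Start with one vertex per arc at each end. Grow at [u] until an event, then at [v] with the blob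
    at [u] kept fixed; the two events contradict [events_clash]. *)
Lemma no_conf u v a b z : conf u v a b z -> short u v a b z -> False.
Proof.
move=> cf sh.
have a0 := conf_nonempty cf; have b0 := conf_nonempty (conf_swap cf).
case: a a0 cf sh => // x1 a _ cf sh; case: b b0 cf sh => // y1 b _ cf sh.
have a0 := conf_size2 cf; have b0 := conf_size2 (conf_swap cf).
case/lastP: a a0 cf sh => // a x2 _ cf sh; case/lastP: b b0 cf sh => // b y2 _ cf sh.
have o_1 := conf_ore_head cf.
have cfr := conf_rev cf; have shr := short_rev sh.
have def_ra : rev (x1 :: rcons a x2) = x2 :: rev (x1 :: a) by rewrite -rcons_cons rev_rcons.
have def_rb : rev (y1 :: rcons b y2) = y2 :: rev (y1 :: b) by rewrite -rcons_cons rev_rcons.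
have o_2 : ore x2 y2 by move: cfr; rewrite def_ra def_rb; apply: conf_ore_head.
have o_l : ore (last u (x1 :: rcons a x2)) (last u (y1 :: rcons b y2)).
  by rewrite /= !last_rcons.
have tl : tail_ok u v z by apply: tail_okP cf sh claw o_1 o_l.
have tlr : tail_ok v u (rev z).
  by apply: (tail_okP def_ra def_rb cfr shr claw o_2); rewrite !last_rev.
have bu : blob u [:: x1] [:: y1].
  apply: blob1 => //; first by have := ore_a cf => /andP[].
  by have := ore_b cf => /andP[].
have bv : blob v (rev [:: x2]) (rev [:: y2]).
  apply: blob1 => //; first by have := ore_a cfr; rewrite def_ra => /andP[].
  by have := ore_b cfr; rewrite def_rb => /andP[].
have [a4 [a5 [b4 [b5 [[def_a def_b bu4 ev] [a4_0 b4_0]]]]]] :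
  exists a4 a5 b4 b5, [/\ x1 :: rcons a x2 = a4 ++ a5 ++ [:: x2],
     y1 :: rcons b y2 = b4 ++ b5 ++ [:: y2], blob u a4 b4 & event u a4 b4]
     /\ (0 < size a4 /\ 0 < size b4).
  have := @blob_event u v [:: x1] a [:: x2] [:: y1] b [:: y2] z.
  by rewrite /= !cats1; apply.
have [a6 [a7 [b6 [b7 [[def_a6 def_b6 bv6 ev6] [a6_0 b6_0]]]]]] :
  exists a6 a7 b6 b7, [/\ rev (x1 :: rcons a x2) = a6 ++ a7 ++ rev a4,
     rev (y1 :: rcons b y2) = b6 ++ b7 ++ rev b4, blob v a6 b6 & event v a6 b6]
     /\ (0 < size a6 /\ 0 < size b6).
  have := @blob_event v u [:: x2] (rev a5) (rev a4) [:: y2] (rev b5) (rev b4) (rev z).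
  have -> : [:: x2] ++ rev a5 ++ rev a4 = rev (x1 :: rcons a x2).
    by rewrite def_a !rev_cat -catA.
  have -> : [:: y2] ++ rev b5 ++ rev b4 = rev (y1 :: rcons b y2).
    by rewrite def_b !rev_cat -catA.
  rewrite !size_rev !revK; apply=> //.
  - by rewrite def_ra def_rb.
  - by rewrite def_ra def_rb.
  - by rewrite !last_rev.
have def_a' : x1 :: rcons a x2 = a4 ++ rev a7 ++ rev a6.
  by rewrite -[LHS]revK def_a6 !rev_cat revK -catA.
have def_b' : y1 :: rcons b y2 = b4 ++ rev b7 ++ rev b6.
  by rewrite -[LHS]revK def_b6 !rev_cat revK -catA.
have cf' := cf; rewrite def_a' def_b' in cf'.
have bv' : blob v (rev (rev a6)) (rev (rev b6)) by rewrite !revK.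
have [m1 m2] := blob_mid cf' bu4 bv'.
apply: (events_clash cf' m1 m2 _ _ bu4 bv' ev); rewrite -?def_a' -?def_b' ?revK //.
Qed.

End Final.

(** * Two-connected graphs *)

Section TwoConnected.

Variable G : sgraph.
Hypothesis G2 : kconnected 2 G.
Implicit Types (x y u v w : G) (s p c : seq G) (X : {set G}).

Lemma path_avoid X x y : #|X| < 2 -> x \notin X -> y \notin X ->
  exists p, [/\ path (@adj G) x p, last x p = y & all [pred w | w \notin X] p].
Proof.
move=> X1 xX yX; have [_ /(_ X X1)[_ conn]] := G2.
have x_in : x \in ~: X by rewrite inE.
have y_in : y \in ~: X by rewrite inE.
have /connectP[p p_path def_y] := conn (exist _ x x_in) (exist _ y y_in).
exists (map val p); split.
- by rewrite -[x]/(val (exist (fun x => x \in ~: X) x x_in)) path_map.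
- by rewrite -[x]/(val (exist (fun x => x \in ~: X) x x_in)) last_map -def_y.
apply/allP=> w /mapP[[w' w'X] _ ->] /=.
by move: w'X; rewrite inE.
Qed.

Definition ear c x y s := [&& x \in c, y \in c, x != y, 0 < size s, uniq s,
  all [pred w | w \notin c] s & path (@adj G) x (rcons s y)].

(** A path from [w] enters the cycle at [u] from an outside vertex [t]; a second path from [t],
    avoiding [u], enters it elsewhere. *)
Lemma ear_exists c w : 1 < size c -> uniq c -> w \notin c -> exists x y s, ear c x y s.
Proof.
move=> c1 c_uniq wc.
have [x0 x0c] : exists x0, x0 \in c by case: (c) c1 => // x0 s _; exists x0; rewrite inE eqxx.
have [|||p [p_path p_last _]] := @path_avoid set0 w x0; rewrite ?cards0 ?inE //.
have [|s1 [u [_ [_ p1 /andP[_ a1] uc]]]] := first_exit (P := [pred t | t \notin c]) p_path wc.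
  by rewrite /= p_last negbK.
move: uc; rewrite /= negbK => uc; set t := last w s1.
have tc : t \notin c.
  have := mem_last w s1; rewrite -/t inE => /orP[/eqP-> // | ts1].
  exact: (allP a1 _ ts1).
have tu : adj t u by move: p1; rewrite rcons_path => /andP[].
have [v vc neq_vu] : exists2 v, v \in c & v != u.
  have : ~~ all (pred1 u) c.
    apply/negP=> /all_pred1P def_c; move: c1 c_uniq; rewrite def_c.
    by case: (size c) => [|[|n]] //=; rewrite inE eqxx.
  by case/allPn=> v vc neq; exists v.
have [|||q [q_path q_last q_out]] := @path_avoid [set u] t v.
- by rewrite cards1.
- by rewrite inE adj_neq.
- by rewrite inE.
case/shortenP: q_path q_last => q' q'_path q'_uniq q'_sub q'_last.
have [|s2 [v' [s3 [def_q' p2 /andP[_ a2] v'c]]]] :=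
  first_exit (P := [pred t | t \notin c]) q'_path tc.
  by rewrite /= q'_last negbK.
have {}a2 : all [pred w | w \notin c] s2 := a2.
exists u, v', (t :: s2); move: v'c; rewrite /= negbK /ear => v'c; rewrite uc v'c /= tc a2.
rewrite adj_sym tu p2 !andbT -[(t \notin s2) && _]/(uniq (t :: s2)).
apply/andP; split.
  have /q'_sub/(allP q_out) : v' \in q' by rewrite def_q' mem_cat inE eqxx orbT.
  by rewrite /= inE eq_sym.
by move: q'_uniq; rewrite def_q' -cat_cons cat_uniq => /and3P[].
Qed.

Lemma ear_min c x y s : ear c x y s -> exists x y s, ear c x y s /\
  forall x' y' s', ear c x' y' s' -> size s <= size s'.
Proof.
move=> ears; pose P m := [exists x : G, [exists y : G, [exists t : m.-tuple G, ear c x y t]]].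
have PP x' y' s' : ear c x' y' s' -> P (size s').
  move=> e; apply/existsP; exists x'; apply/existsP; exists y'.
  by apply/existsP; exists (in_tuple s').
have exP : exists m, P m by exists (size s); apply: PP ears.
case: (ex_minnP exP) => m /existsP[x1 /existsP[y1 /existsP[t e]]] min_m.
by exists x1, y1, t; split=> // x' y' s' /PP/min_m; rewrite size_tuple.
Qed.

(** An edge counts as an Ore-cycle of size 2, so a maximum exists; [ore_cycle_adj] makes the maximal
    cycle genuine. *)
Lemma longest_cycle : exists y q, [/\ uniq (y :: q), path (@adj G) y (rcons q y), 0 < size q
  & forall c, uniq c -> cycle (@ore G) c -> size c <= (size q).+1].
Proof.
pose P m := [exists t : m.-tuple G, uniq t && cycle (@ore G) t].
have PP c : uniq c -> cycle (@ore G) c -> P (size c).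
  by move=> U o; apply/existsP; exists (in_tuple c); rewrite U o.
have P2 : P 2.
  have [n3 _] := G2.
  have [x _] : exists x : G, true by have /card_gt0P[x _] : 0 < #|G| by lia; exists x.
  have [y neq] : exists y, y != x.
    have : 0 < #|predC1 x| by have := cardC1 x; lia.
    by case/card_gt0P=> y; exists y.
  have [|||p [p_path p_last _]] := @path_avoid set0 x y; rewrite ?cards0 ?inE //.
  case: p p_path p_last => [_ def_y|w p /andP[xw _] _]; first by rewrite -def_y eqxx in neq.
  by apply: (PP [:: x; w]); rewrite /= ?inE ?adj_neq ?adj_ore // adj_sym.
have bnd m : P m -> m <= #|G|.
  case/existsP=> t /andP[U _]; rewrite -(size_tuple t) -(card_uniqP U); exact: max_card.
case: (ex_maxnP (ex_intro _ 2 P2) bnd) => m /existsP[[t /= /eqP t_size] /andP[/= U o]] max_m.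
case: t t_size U o => [|x p] t_size U o; first by have := max_m _ P2; rewrite -t_size.
have c_max c : uniq c -> cycle (@ore G) c -> size c <= (size p).+1.
  by move=> U' o'; rewrite -[(size p).+1]/(size (x :: p)) t_size; apply/max_m/PP.
have [y [q [U' p' sz]]] := ore_cycle_adj U o c_max.
exists y, q; split=> //; rewrite sz //.
by have := max_m _ P2; rewrite -t_size.
Qed.

Theorem hamiltonian_of_heavy :
  claws_heavy G -> nets_heavy G \/ woundeds_heavy G -> hamiltonian G.
Proof.
move=> claw pats; have [y [q [U c_cyc q0 c_max]]] := longest_cycle.
set c := y :: q; have [|] := boolP [forall x, x \in c].
  move=> /forallP all_c; exists c; split=> //; first by apply/andP.
  have [n3 _] := G2; rewrite -(card_uniqP (U : uniq c)).
  by apply: leq_trans n3 _; apply: subset_leq_card; apply/subsetP=> x _; apply: all_c.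
case/forallPn=> w wc; exfalso.
have [x0 [y0 [s0 e0]]] := ear_exists (q0 : 1 < size c) U wc.
have [u [v [z [/and5P[uc vc neq z0 /and3P[Uz az p_z]] min_z]]]] := ear_min e0.
have [i c' def_c] := rot_to uc.
have cyc' : cycle (@adj G) (u :: c') by rewrite -def_c rot_cycle.
have vc' : v \in c'.
  by have := vc; rewrite -(mem_rot i) def_c inE eq_sym (negPf neq).
have [a [b' def_c']] := in_split vc'.
(* The second arc is reversed so that both arcs run from [u] to [v]. *)
have perm_c : perm_eq c (u :: v :: a ++ rev b').
  have : perm_eq (rot i c) c by rewrite perm_rot.
  by rewrite def_c def_c' perm_sym => /perm_trans; apply; count_perm.
have sz_c : (size q).+1 = (size a + size (rev b')).+2.
  by rewrite -size_cat; have /perm_size := perm_c.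
have mem_c x : (x \in u :: v :: a ++ rev b') = (x \in c).
  by rewrite (perm_mem perm_c).
have cf : conf u v a (rev b') z.
  move: cyc'; rewrite def_c' /= rcons_cat cat_path /= => /and3P[pa av pb].
  split=> //; try by rewrite -sz_c.
  - rewrite (perm_uniq (_ : perm_eq _ ((u :: v :: a ++ rev b') ++ z))); last by count_perm.
    rewrite cat_uniq -(perm_uniq perm_c) U Uz andbT; apply/hasPn=> x /(allP az).
    by rewrite /= mem_c.
  - by rewrite rcons_path pa.
  exact: rev_adj_path.
apply: (no_conf claw pats cf) => x' y' s'; rewrite !mem_c => xc yc nxy s'0 Us' dis ps'.
apply: (min_z x' y'); rewrite /ear xc yc nxy s'0 Us' ps' andbT /=.
by apply/allP=> x /dis; rewrite /= mem_c.
Qed.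

End TwoConnected.

(** * Heavy patterns *)

Lemma isomorphic_sym (G H : sgraph) : isomorphic G H -> isomorphic H G.
Proof.
case=> f [[g fK gK] f_adj]; exists g; split; first by exists f.
by move=> x y; rewrite -f_adj !gK.
Qed.

Lemma isomorphic_trans (G H K : sgraph) :
  isomorphic G H -> isomorphic H K -> isomorphic G K.
Proof.
case=> f [f_bij f_adj] [g [g_bij g_adj]]; exists (g \o f).
by split=> [|x y /=]; [apply: bij_comp | rewrite g_adj].
Qed.

Lemma heavy_iso (S H G : sgraph) : isomorphic S H -> heavy S G -> heavy H G.
Proof.
move=> isoSH hS A isoA; apply: hS.
exact: isomorphic_trans isoA (isomorphic_sym isoSH).
Qed.

Section Pattern.

Variable G : sgraph.
Local Notation far := (@far G).

Definition pattern (r : rel nat) (t : seq G) (x0 : G) :=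
  all (fun j => all (fun i => if r i j || r j i
      then adj (nth x0 t i) (nth x0 t j) else far (nth x0 t i) (nth x0 t j))
    (iota 0 j)) (iota 0 (size t)).

Lemma light_pattern (r : rel nat) (t : seq G) (x0 : G) :
  pattern r t x0 -> ~ heavy (ord_graph (size t) r) G.
Proof.
move=> pat hH.
have pat_lt i j : i < j -> j < size t -> if r i j || r j i
    then adj (nth x0 t i) (nth x0 t j) else far (nth x0 t i) (nth x0 t j).
  move=> lt_ij lt_j; have /allP/(_ j) := pat; rewrite mem_iota add0n lt_j.
  by move=> /(_ isT)/allP/(_ i); rewrite mem_iota add0n lt_ij; apply.
have pat_ne i j : i != j -> i < size t -> j < size t -> if r i j || r j i
    then adj (nth x0 t i) (nth x0 t j) else far (nth x0 t i) (nth x0 t j).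
  rewrite neq_ltn => /orP[] lt_ij lt_i lt_j; first by apply: pat_lt.
  by rewrite orbC adj_sym far_sym; apply: pat_lt.
have nth_ne i j : i != j -> i < size t -> j < size t -> nth x0 t i != nth x0 t j.
  move=> neq lt_i lt_j; have := pat_ne i j neq lt_i lt_j.
  by case: ifP => _; [apply: adj_neq | case/andP].
have t_uniq : uniq t.
  apply/(uniqP x0) => i j; rewrite !inE => lt_i lt_j e; apply/eqP/idPn=> neq.
  by have := nth_ne i j neq lt_i lt_j; rewrite e eqxx.
pose A := [set x in t].
have nthA (i : 'I_(size t)) : nth x0 t i \in A by rewrite inE mem_nth.
have idx (x : induced A) : index (val x) t < size t.
  by rewrite index_mem; have := valP x; rewrite inE.
have [x [y [xA yA neq nadj big]]] : heavy_set A.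
  apply: hH; exists (fun x => Ordinal (idx x)); split.
    exists (fun i => exist (fun x => x \in A) _ (nthA i)) => [x | i].
      by apply/val_inj => /=; rewrite nth_index //; have := valP x; rewrite inE.
    by apply/val_inj; rewrite /= index_uniq.
  move=> x y; rewrite /= /ord_adj /induced_adj /=.
  have xt : val x \in t by have := valP x; rewrite inE.
  have yt : val y \in t by have := valP y; rewrite inE.
  case: eqP => [[e] | /eqP neq] /=.
    have -> : val x = val y by rewrite -(nth_index x0 xt) e nth_index.
    by rewrite adj_irrefl.
  have := pat_ne _ _ (neq : index (val x) t != index (val y) t) (idx x) (idx y).
  by rewrite !nth_index //; case: ifP => _ => [-> // | /far_nadj].
move: xA yA; rewrite !inE => xA yA.
have neq_i : index x t != index y t.
  by apply: contraNneq neq => e; rewrite -(nth_index x0 xA) e nth_index.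
have := pat_ne _ _ neq_i; rewrite !index_mem !nth_index // => /(_ xA yA).
case: ifP => _; first by apply/negP.
by rewrite farE => /and3P[_ _ /negP[]].
Qed.

End Pattern.

Ltac solve_pattern :=
  rewrite /pattern /= ?inE /= ?andbT;
  repeat match goal with |- is_true (_ && _) => apply/andP; split end;
  solve [done | by rewrite adj_sym | by rewrite far_sym].

Section Partners.

Variable G : sgraph.
Local Notation far := (@far G).

Lemma claws_heavyP : heavy claw G -> claws_heavy G.
Proof.
move=> hG c x y w * ?; apply: (@light_pattern G _ [:: c; x; y; w] c _ hG).
 solve_pattern.
Qed.

Lemma nets_heavyP : heavy net G -> nets_heavy G.
Proof.
move=> hG x0 x1 x2 x3 x4 x5 * ?.
apply: (@light_pattern G _ [:: x0; x1; x2; x3; x4; x5] x0 _ hG).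
by solve_pattern.
Qed.

Lemma woundeds_heavyP : heavy wounded G -> woundeds_heavy G.
Proof.
move=> hG x0 x1 x2 x3 x4 x5 * ?.
apply: (@light_pattern G _ [:: x0; x1; x2; x3; x4; x5] x0 _ hG).
by solve_pattern.
Qed.

(** The list [k] names the vertices of the wounded graph that carry the smaller pattern, so a light
    wounded graph contains a light copy of it. *)
Lemma woundeds_heavy_sub (n : nat) (r : rel nat) (k : seq nat) : size k = n ->
  (forall x0 x1 x2 x3 x4 x5 : G,
  adj x0 x1 -> adj x1 x2 -> adj x0 x2 -> adj x0 x3 -> adj x1 x4 -> adj x4 x5 ->
  far x0 x4 -> far x0 x5 -> far x1 x3 -> far x1 x5 -> far x2 x3 -> far x2 x4 ->
  far x2 x5 -> far x3 x4 -> far x3 x5 ->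
  pattern r [seq nth x0 [:: x0; x1; x2; x3; x4; x5] i | i <- k] x0) ->
  heavy (ord_graph n r) G -> woundeds_heavy G.
Proof.
move=> <- pat hG x0 x1 x2 x3 x4 x5 * ?.
have := @light_pattern G r [seq nth x0 [:: x0; x1; x2; x3; x4; x5] i | i <- k] x0.
by rewrite size_map; apply; first exact: pat.
Qed.

Lemma partner_heavy S : heavy_partner S -> heavy S G ->
  nets_heavy G \/ woundeds_heavy G.
Proof.
have sub n r k := @woundeds_heavy_sub n r k.
case=> [|[|[|[|[|[|[|]]]]]]] /heavy_iso isoS /isoS {isoS} hG.
- right; apply: (sub _ _ [:: 3; 0; 1; 4] erefl _ hG) => *; by solve_pattern.
- right; apply: (sub _ _ [:: 3; 0; 1; 4; 5] erefl _ hG) => *; by solve_pattern.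
- right; apply: (sub _ _ [:: 0; 1; 2] erefl _ hG) => *; by solve_pattern.
- right; apply: (sub _ _ [:: 1; 2; 0; 3] erefl _ hG) => *; by solve_pattern.
- right; apply: (sub _ _ [:: 0; 2; 1; 4; 5] erefl _ hG) => *; by solve_pattern.
- right; apply: (sub _ _ [:: 0; 1; 2; 3; 4] erefl _ hG) => *; by solve_pattern.
- by left; apply: nets_heavyP.
by right; apply: woundeds_heavyP.
Qed.

End Partners.

(** * Searches in concrete graphs *)

Definition nadj (r : rel nat) : rel nat := fun i j => (i != j) && (r i j || r j i).

Definition ndeg n r i := count (nadj r i) (iota 0 n).

Definition list_graph (r : rel nat) (s : seq nat) :=
  ord_graph (size s) (fun i j => nadj r (nth 0 s i) (nth 0 s j)).

Fixpoint sublists (s : seq nat) : seq (seq nat) :=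
  if s is x :: s' then sublists s' ++ map (cons x) (sublists s') else [:: [::]].

(* vm_compute is call-by-value, so the search functions branch with [if] where the
   boolean connectives would evaluate both arguments. *)
Fixpoint lazy_has (P : pred nat) s :=
  if s is x :: s' then if P x then true else lazy_has P s' else false.

Lemma lazy_hasE P s : lazy_has P s = has P s.
Proof. by elim: s => //= x s ->. Qed.

Fixpoint lazy_all (T : Type) (P : pred T) s :=
  if s is x :: s' then if P x then lazy_all P s' else false else true.

Lemma lazy_allE (T : Type) (P : pred T) s : lazy_all P s = all P s.
Proof. by elim: s => //= x s ->. Qed.

(** Backtracking search: [acc] holds the vertex pairs chosen so far, and each new pair is tested
    against all of them. *)
Fixpoint embeds (C : rel (nat * nat)) n (todo : seq nat) (acc : seq (nat * nat)) :=
  if todo is x :: todo' then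
    lazy_has (fun v => if lazy_all (C (x, v)) acc then embeds C n todo' ((x, v) :: acc)
                       else false) (iota 0 n)
  else true.

Definition same_adj r1 r2 : rel (nat * nat) := fun p q =>
  if p.2 != q.2 then nadj r1 p.1 q.1 == nadj r2 p.2 q.2 else false.

(** The degree list is bound before the pair arguments, so it is evaluated once for a whole
    search. *)
Definition light_adj r1 n r2 : rel (nat * nat) :=
  let ds := [seq ndeg n r2 i | i <- iota 0 n] in fun p q =>
  if same_adj r1 r2 p q then
    if nadj r2 p.2 q.2 then true else nth 0 ds p.2 + nth 0 ds q.2 < n
  else false.

(** Closure of the computed set is tested again, so a positive answer is a certificate whatever the
    number of iterations. *)
Definition disconnected r s :=
  let X := iter (size s) (fun X => [seq y <- s | (y \in X) || has (nadj r y) X])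
                [:: head 0 s] in
  all (fun y => (y \in X) || ~~ has (nadj r y) X) s && ~~ all (mem X) s.

(** The value [k = n] deletes nothing, so one test covers connectivity and all single deletions. *)
Definition connected_without n r k :=
  let V := filter (predC1 k) (iota 0 n) in
  let X := iter n (fun X => [seq y <- V | (y \in X) || has (nadj r y) X])
                [:: head 0 V] in
  (0 < size V) && all (mem X) V.

Fixpoint ham_search r k x (todo : seq nat) :=
  if k is k'.+1 then
    lazy_has (fun v => if nadj r x v then ham_search r k' v (filter (predC1 v) todo)
                       else false) todo
  else nadj r x 0.

Lemma nadj_sym r : symmetric (nadj r).
Proof. by move=> i j; rewrite /nadj eq_sym orbC. Qed.

Lemma nadjE n r (i j : 'I_n) : nadj r i j = ord_adj r i j.
Proof. by []. Qed.

Lemma list_adj r s (i j : list_graph r s) :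
  adj i j = nadj r (nth 0 s i) (nth 0 s j).
Proof.
rewrite /= /ord_adj [nadj r (nth 0 s j) _]nadj_sym orbb.
by case: eqP => // ->; rewrite /nadj eqxx.
Qed.

Lemma deg_ord n r (i : ord_graph n r) : deg i = ndeg n r i.
Proof.
rewrite /deg /ndeg cardsE cardE size_filter -val_enum_ord count_map -enumT.
by apply: eq_count => j.
Qed.

Lemma filter_sublists P s : filter P s \in sublists s.
Proof.
elim: s => //= x s IHs; rewrite mem_cat; case: (P x); last by rewrite IHs.
by rewrite [X in _ || X]map_f ?orbT.
Qed.

Lemma connected_iso (S H : sgraph) : isomorphic S H -> connected_graph S -> connected_graph H.
Proof.
case=> f [[g fK gK] f_adj] [S0 conn]; split.
  by have /card_gt0P[x _] := S0; apply/card_gt0P; exists (f x).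
move=> x y; have /connectP[p p_path def_y] := conn (g x) (g y).
apply/connectP; exists (map f p); last by rewrite -{1}(gK x) last_map -def_y gK.
rewrite -(gK x) path_map; apply: sub_path p_path => z w.
by rewrite /= f_adj.
Qed.

Lemma card_iso (S H : sgraph) : isomorphic S H -> #|S| = #|H|.
Proof. by case=> f [/bij_eq_card]. Qed.

Section LightCopies.

Variables (S : sgraph) (n : nat) (r : rel nat).

Lemma light_copy : ~ heavy S (ord_graph n r) -> exists2 A : {set ord_graph n r},
  isomorphic (induced A) S & ~ heavy_set A.
Proof.
move=> nh; apply: NNPP => nex; apply: nh => A isoA.
by apply: NNPP => nhA; apply: nex; exists A.
Qed.

Lemma light_sublist : ~ heavy S (ord_graph n r) ->
  exists2 s, s \in sublists (iota 0 n) & isomorphic S (list_graph r s).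
Proof.
case/light_copy=> A isoA _.
pose P k := if insub k is Some i then (i : 'I_n) \in A else false.
pose s := filter P (iota 0 n); exists s; first exact: filter_sublists.
apply: isomorphic_trans (isomorphic_sym isoA) _.
have PE (i : 'I_n) : P i = (i \in A) by rewrite /P valK.
have s_uniq : uniq s by rewrite filter_uniq ?iota_uniq.
have in_s (x : induced A) : nat_of_ord (val x) \in s.
  by rewrite mem_filter PE (valP x) mem_iota /= add0n.
have idx (x : induced A) : index (nat_of_ord (val x)) s < size s by rewrite index_mem.
have lt_n (i : 'I_(size s)) : nth 0 s i < n.
  by have := mem_nth 0 (ltn_ord i); rewrite mem_filter mem_iota => /and3P[].
have nthA (i : 'I_(size s)) : Ordinal (lt_n i) \in A.
  by have := mem_nth 0 (ltn_ord i); rewrite mem_filter -PE => /andP[].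
exists (fun x => Ordinal (idx x)); split.
  exists (fun i => exist (fun x => x \in A) _ (nthA i)) => [x | i].
    by apply/val_inj/val_inj; apply: (nth_index 0 (in_s x)).
  by apply/val_inj; rewrite /= index_uniq.
move=> x y; rewrite list_adj -[RHS]/(nadj r (\val x) (\val y)).
by congr (nadj r _ _); apply: nth_index.
Qed.

(** The search can always choose the image [h] of the current vertex in a light copy. Read
    contrapositively, a failed search proves heaviness. *)
Lemma light_embeds r1 s : ~ heavy S (ord_graph n r) -> uniq s ->
  isomorphic S (list_graph r1 s) -> embeds (light_adj r1 n r) n s [::].
Proof.
case/light_copy=> A isoA nhA s_uniq isoS.
have [f [[g fK gK] f_adj]] := isomorphic_sym (isomorphic_trans isoA isoS).
pose h k := if insub (index k s) is Some i then nat_of_ord (val (f i)) else 0.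
have hP x : x \in s -> {i : 'I_(size s) | x = nth 0 s i & h x = val (f i)}.
  rewrite -index_mem => lt_x; exists (Ordinal lt_x); first by rewrite nth_index // -index_mem.
  by rewrite /h insubT.
have lt_h x : x \in s -> h x < n by case/hP=> i _ ->; apply: ltn_ord.
have hC x y : x \in s -> y \in s -> x != y -> light_adj r1 n r (x, h x) (y, h y).
  move=> /hP[i -> ->] /hP[j -> ->]; rewrite nth_uniq // => neq_ij.
  have neq_f : f i != f j.
    by apply: contraNneq neq_ij => /(can_inj fK) ->.
  have neq_v : nat_of_ord (val (f i)) != val (f j).
    by apply: contraNneq neq_f => e; apply/eqP/val_inj/val_inj.
  have := f_adj i j; rewrite list_adj -[LHS]/(nadj r (\val (f i)) (\val (f j))) => fa.
  rewrite /light_adj /same_adj /= neq_v fa eqxx /=; case nad: (nadj _ _ _) => //=.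
  have nth_deg (w : ord_graph n r) : nth 0 [seq ndeg n r i | i <- iota 0 n] w = ndeg n r w.
    by rewrite (nth_map 0) ?size_iota // nth_iota.
  rewrite !nth_deg ltnNge; apply/negP; rewrite -(deg_ord (val (f i))) -(deg_ord (val (f j))).
  move=> big; case: nhA.
  exists (val (f i)), (val (f j)); rewrite card_ord big; split=> //; try exact: valP.
  by rewrite /= -nadjE fa nad.
suff H todo acc : {subset todo <= s} -> uniq (todo ++ map fst acc) ->
    all (fun p => (p.1 \in s) && (p.2 == h p.1)) acc ->
    embeds (light_adj r1 n r) n todo acc.
  by apply: H; rewrite ?cats0.
elim: todo acc => //= x todo IH acc sub U def_acc.
have xs : x \in s by apply: sub; rewrite inE eqxx.
rewrite lazy_hasE; apply/hasP; exists (h x); first by rewrite mem_iota /= add0n lt_h.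
apply/andP; split.
  rewrite lazy_allE; apply/allP=> -[y v] p_acc.
  have /andP[/= ys /eqP->] := allP def_acc _ p_acc.
  apply: hC => //; case/andP: U => + _; rewrite mem_cat negb_or => /andP[_].
  by apply: contraNneq => ->; apply: map_f p_acc.
apply: IH; last by rewrite /= xs eqxx.
  by move=> y y_in; apply: sub; rewrite inE y_in orbT.
by rewrite (perm_uniq (_ : perm_eq _ ((x :: todo) ++ map fst acc))) //=; count_perm.
Qed.

End LightCopies.

Lemma list_graph_perm r s t : uniq s -> perm_eq s t ->
  isomorphic (list_graph r s) (list_graph r t).
Proof.
move=> s_uniq st; have t_uniq : uniq t by rewrite -(perm_uniq st).
have idx (i : 'I_(size s)) : index (nth 0 s i) t < size t.
  by rewrite index_mem -(perm_mem st) mem_nth.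
have idx' (i : 'I_(size t)) : index (nth 0 t i) s < size s.
  by rewrite index_mem (perm_mem st) mem_nth.
have in_t (i : 'I_(size s)) : nth 0 s i \in t by rewrite -(perm_mem st) mem_nth.
have in_s (i : 'I_(size t)) : nth 0 t i \in s by rewrite (perm_mem st) mem_nth.
exists (fun i => Ordinal (idx i)); split.
  by exists (fun i => Ordinal (idx' i)) => i; apply/val_inj; rewrite /= nth_index ?index_uniq.
by move=> i j; rewrite !list_adj !nth_index.
Qed.

Lemma embeds_sound C n todo acc : pairwise C acc -> embeds C n todo acc ->
  exists2 L, pairwise C L /\ unzip1 L = rev todo ++ unzip1 acc
           & all (fun p => (p \in acc) || (p.2 < n)) L.
Proof.
elim: todo acc => [|x todo IH] acc acc_C /=.
  by move=> _; exists acc => //; apply/allP=> p ->.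
rewrite lazy_hasE; case/hasP=> v; rewrite mem_iota => /andP[_ lt_v] /andP[].
rewrite lazy_allE => vC.
case/IH=> [|L [L_C def_L] L_n]; first by rewrite /= vC.
exists L; first by rewrite def_L rev_cons cat_rcons.
apply/allP=> p /(allP L_n); rewrite inE => /orP[/orP[/eqP->|->//]|->]; rewrite ?orbT //.
by rewrite lt_v orbT.
Qed.

Lemma embeds_iso r1 n r2 s : uniq s -> size s = n -> embeds (same_adj r1 r2) n s [::] ->
  isomorphic (list_graph r1 s) (ord_graph n r2).
Proof.
move=> s_uniq s_size /embeds_sound[//|L [L_C]]; rewrite cats0 => L1 /allP L_n.
have s1 : size (unzip1 L) = size L by rewrite size_map.
have s2 : size (unzip2 L) = size L by rewrite size_map.
have sL : size L = n by rewrite -s1 L1 size_rev.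
have L_nth i j : i < j -> j < size L -> same_adj r1 r2 (nth (0, 0) L i) (nth (0, 0) L j).
  move=> lt_ij lt_j; have /(pairwiseP (0, 0)) := L_C.
  by apply=> //; rewrite inE // (ltn_trans lt_ij).
have L_ne i j : i != j -> i < size L -> j < size L ->
    same_adj r1 r2 (nth (0, 0) L i) (nth (0, 0) L j).
  rewrite neq_ltn => /orP[] lt_ij lt_i lt_j; first exact: L_nth.
  by have := L_nth _ _ lt_ij lt_i; rewrite /same_adj eq_sym nadj_sym [nadj r2 _ _]nadj_sym.
have nL (i : 'I_(size (rev s))) : (nth (0, 0) L i).2 < n.
  have lt_i : i < size L by rewrite -s1 L1.
  by have := L_n _ (mem_nth (0, 0) lt_i).
(* The search accumulates in front, so the images come in the order of [rev s]. *)
apply: isomorphic_trans (list_graph_perm _ s_uniq (_ : perm_eq s (rev s))) _.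
  by rewrite perm_sym perm_rev.
have lt_s (i : 'I_(size (rev s))) : i < size L by rewrite -s1 L1.
exists (fun i => Ordinal (nL i)); split.
  apply: inj_card_bij; last by rewrite !card_ord size_rev s_size.
  move=> i j [e]; apply/eqP/idPn=> neq.
  by have := L_ne i j neq (lt_s i) (lt_s j); rewrite /same_adj e eqxx.
move=> i j; rewrite list_adj -[LHS]/(nadj r2 (nth (0, 0) L i).2 (nth (0, 0) L j).2).
case: (altP (i =P j)) => [-> | neq]; first by rewrite /nadj !eqxx.
have /andP[_ /eqP] := L_ne i j neq (lt_s i) (lt_s j).
have nth_s (k : 'I_(size (rev s))) : (nth (0, 0) L k).1 = nth 0 (rev s) k.
  by move: (lt_s k); move: (nat_of_ord k) => k' lt_k; rewrite -L1 (nth_map (0, 0)).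
by rewrite !nth_s => ->.
Qed.

Lemma connected_list_graph r s : uniq s -> connected_graph (list_graph r s) ->
  ~~ disconnected r s.
Proof.
move=> s_uniq [s0 conn]; rewrite card_ord in s0.
rewrite /disconnected; set f := fun _ => _; set X := iter _ _ _.
have X0 : head 0 s \in X.
  rewrite /X; elim: (size s) => [|k IHk]; first by rewrite inE eqxx.
  by rewrite iterS /f mem_filter IHk; case: (s) s0 => //= x s' _; rewrite inE eqxx.
apply/negP=> /andP[/allP clX /allP[]] x xs.
have lt_x : index x s < size s by rewrite index_mem.
pose a := [pred i : 'I_(size s) | nth 0 s i \in X].
have cl : closed (@adj (list_graph r s)) a.
  apply: (intro_closed (sym_connect_sym (@adj_sym (list_graph r s)))).
  move=> i j; rewrite list_adj !inE => ad iX; have := clX (nth 0 s j) (mem_nth 0 (ltn_ord j)).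
  case/orP=> // /hasPn/(_ _ iX); rewrite nadj_sym; by move/negP.
have := closed_connect cl (conn (Ordinal s0) (Ordinal lt_x)).
by rewrite !inE /= nth0 X0 nth_index // => <-.
Qed.

Lemma connected_without_path n r k (x y : ord_graph n r) :
  connected_without n r k -> nat_of_ord x != k -> nat_of_ord y != k ->
  connect [rel i j : ord_graph n r | adj i j && ((nat_of_ord i != k) && (nat_of_ord j != k))] x y.
Proof.
rewrite /connected_without; set V := filter _ _; set f := fun _ => _; set X := iter _ _ _.
case/andP=> V0 /allP VX xk yk; set e := [rel i j | _].
have inV (z : ord_graph n r) : nat_of_ord z != k -> nat_of_ord z \in V.
  by move=> zk; rewrite mem_filter mem_iota /= add0n zk ltn_ord.
have V_lt z : z \in V -> z < n by rewrite mem_filter mem_iota => /and3P[].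
have h_in : head 0 V \in V by case: (V) V0 => // z V' _; rewrite inE eqxx.
pose h : ord_graph n r := Ordinal (V_lt _ h_in).
have e_sym : connect_sym e.
  apply: sym_connect_sym => i j; rewrite /e /= -!nadjE nadj_sym.
  by rewrite [(nat_of_ord i != k) && _]andbC.
suff hX m z : z \in iter m f [:: head 0 V] ->
    forall z' : ord_graph n r, nat_of_ord z' = z -> connect e h z'.
  have hx (z : ord_graph n r) : nat_of_ord z != k -> connect e h z.
    by move=> zk; apply: (hX n z _ z erefl); apply: (VX z); apply: inV.
  by apply: (@connect_trans _ _ h); [rewrite e_sym|]; apply: hx.
elim: m z => [|m IHm] z /=.
  by rewrite inE => /eqP-> z' def_z'; have -> : z' = h by apply: val_inj.
rewrite {1}/f mem_filter => /andP[/orP[zX _ | /hasP[w wX ezw] zV]] z' def_z'.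
  exact: IHm zX _ def_z'.
have wV : w \in V.
  case: m {IHm} wX => [|m] /=; first by rewrite inE => /eqP->.
  by rewrite mem_filter => /andP[].
have IH := IHm w wX (Ordinal (V_lt _ wV)) erefl.
apply: connect_trans IH (connect1 _); rewrite /e /= -nadjE /= def_z' nadj_sym ezw.
by move: wV zV; rewrite !mem_filter /= => /andP[-> _] /andP[-> _].
Qed.

Lemma kconnected2P n r : 2 < n -> all (connected_without n r) (iota 0 n.+1) ->
  kconnected 2 (ord_graph n r).
Proof.
move=> n3 /allP conn; split=> [|X X2]; first by rewrite card_ord.
have [k [lt_k kX]] : exists k, k < n.+1 /\
    (forall z : ord_graph n r, (nat_of_ord z != k) = (z \notin X)).
  have [X0 | X1] : #|X| = 0 \/ #|X| = 1 by lia.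
    exists n; split=> // z; rewrite (cards0_eq X0) inE.
    by apply/eqP=> e; have := ltn_ord z; rewrite e ltnn.
  have /cards1P[w ->] : #|X| == 1 by apply/eqP.
  exists (nat_of_ord w); split; first exact: ltnW (ltn_ord w).
  by move=> z; rewrite inE.
have ck : connected_without n r k by apply: conn; rewrite mem_iota.
split.
  have := ck; rewrite /connected_without; set V := filter _ _ => /andP[V0 _].
  have h_in : head 0 V \in V by case: (V) V0 => // z V' _; rewrite inE eqxx.
  have h_lt : head 0 V < n by move: h_in; rewrite mem_filter mem_iota => /and3P[].
  have hX : (Ordinal h_lt : ord_graph n r) \in ~: X.
    by rewrite inE -kX; move: h_in; rewrite mem_filter => /andP[].
  by apply/card_gt0P; exists (exist (fun z => z \in ~: X) _ hX).
move=> [x xX] [y yX]; have xk : nat_of_ord x != k by rewrite kX -in_setC.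
have yk : nat_of_ord y != k by rewrite kX -in_setC.
have /connectP[p] := connected_without_path ck xk yk.
elim: p x xX xk => [|z p IHp] x xX xk /=.
  move=> _ def_y; subst y; rewrite (bool_irrelevance xX yX); exact: connect0.
case/andP=> /and3P[xz _ zk] p_path def_y.
have zX : z \in ~: X by rewrite in_setC -kX.
by apply: connect_trans (connect1 _) (IHp z zX zk p_path def_y).
Qed.

Lemma ham_searchP n r : hamiltonian (ord_graph n.+1 r) ->
  ham_search r n 0 (iota 1 n).
Proof.
case=> c [/andP[c_cyc c_uniq] _ all_c].
have [i p def_c] := rot_to (all_c (ord0 : ord_graph n.+1 r)).
have : cycle (@adj (ord_graph n.+1 r)) (rot i c) by rewrite rot_cycle.
have : uniq (rot i c) by rewrite rot_uniq.
have sz : size (rot i c) = n.+1.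
  rewrite size_rot -(card_uniqP c_uniq) -[RHS]card_ord.
  by apply: eq_card => x; rewrite all_c.
rewrite def_c /= in sz *; move=> /andP[p0 p_uniq] p_path.
have def_n : size p = n by case: sz.
suff H q x todo : path (@adj (ord_graph n.+1 r)) x (rcons q ord0) -> uniq q ->
    (forall w : 'I_n.+1, w \in q -> nat_of_ord w \in todo) ->
    ham_search r (size q) x todo.
  have := H p ord0 (iota 1 n); rewrite def_n; apply=> // w wp.
  rewrite mem_iota add1n ltn_ord andbT lt0n.
  by apply: contraNneq p0 => w0; have <- : w = ord0 by apply: val_inj.
elim: q x todo => [|y q IHq] x todo /=; first by rewrite andbT.
case/andP=> xy q_path /andP[yq q_uniq] sub.
rewrite lazy_hasE; apply/hasP; exists (nat_of_ord y); first by apply: sub; rewrite inE eqxx.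
rewrite nadjE xy; apply: IHq => // w wq; rewrite mem_filter sub ?inE ?wq ?orbT // andbT /=.
by apply: contraNneq yq => e; have <- : w = y by apply: val_inj.
Qed.

(** * The four non-Hamiltonian graphs *)

(* [nbrs l] lists for each vertex its neighbours of larger index. *)
Definition nbrs (l : seq (seq nat)) : rel nat := fun i j => j \in nth [::] l i.

Definition k23 := nbrs [:: iota 2 3; iota 2 3].

(* Vertex i of the triangle 0 1 2 is joined by the path i, i + 3, i + 6 to the
   triangle 6 7 8; in pTTT these paths are completed to triangles. *)
Definition p333 := nbrs
  [:: [:: 1; 2; 3]; [:: 2; 4]; [:: 5]; [:: 6]; [:: 7]; [:: 8]; [:: 7; 8]; [:: 8]].

Definition pTTT := nbrs
  [:: [:: 1; 2; 3; 6]; [:: 2; 4; 7]; [:: 5; 8]; [:: 6]; [:: 7]; [:: 8];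
      [:: 7; 8]; [:: 8]].

(* In pTTT, the triangle 0 1 2 is replaced by K_8 minus the triangle 0 1 2: the
   pairs in {0, 1, 2} become heavy non-edges, which makes every induced P_6 heavy. *)
Definition pK8 := nbrs
  [:: [:: 3, 6 & iota 9 5]; [:: 4, 7 & iota 9 5]; [:: 5, 8 & iota 9 5];
      [:: 6]; [:: 7]; [:: 8]; [:: 7; 8]; [:: 8]; [::];
      iota 10 4; iota 11 3; iota 12 2; iota 13 1].

(** These relations are convertible with those inside the graphs of the statement, so a result on
    [ord_graph n path_rel] is one on [path_graph n]. *)
Definition path_rel : rel nat := fun i j => j == i.+1.
Definition Z_rel : rel nat := fun u v => (v == u.+1) || ((u, v) == (0, 2)).
Definition edge_rel (s : seq (nat * nat)) : rel nat := fun i j => (i, j) \in s.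

Definition claw_rel := edge_rel [:: (0, 1); (0, 2); (0, 3)].

Definition partners : seq (nat * rel nat) :=
  [:: (4, path_rel); (5, path_rel); (3, edge_rel [:: (0, 1); (1, 2); (0, 2)]);
      (4, Z_rel); (5, Z_rel);
      (5, edge_rel [:: (0, 1); (1, 2); (0, 2); (0, 3); (1, 4)]);
      (6, edge_rel [:: (0, 1); (1, 2); (0, 2); (0, 3); (1, 4); (2, 5)]);
      (6, edge_rel [:: (0, 1); (1, 2); (0, 2); (0, 3); (1, 4); (4, 5)])].

Definition iso_check r1 s n r2 :=
  if size s == n then embeds (same_adj r1 r2) n s [::] else false.

(** The only heavy non-edge of $K_{2,3}$ is between its two vertices of degree 3; a connected
    subgraph avoiding one of them is a star. *)
Definition claw_check s :=
  if size s <= 2 then true else if disconnected k23 s then true else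
  if iso_check k23 s 3 path_rel then true else
  if iso_check k23 s 4 claw_rel then true else
  ~~ embeds (light_adj k23 5 k23) 5 s [::].

(** The candidates are the induced subgraphs of [p333]; the search in the 14-vertex graph runs only
    on those with a light copy in [pTTT]. *)
Definition partner_check s :=
  if size s <= 2 then true else if disconnected p333 s then true else
  if iso_check p333 s 3 path_rel then true else
  if has (fun t => iso_check p333 s t.1 t.2) partners then true else
  if embeds (light_adj p333 9 pTTT) 9 s [::]
  then ~~ embeds (light_adj p333 14 pK8) 14 s [::] else true.

Lemma claw_check_all : all claw_check (sublists (iota 0 5)).
Proof. by vm_compute. Qed.

Lemma partner_check_all : all partner_check (sublists (iota 0 9)).
Proof. by vm_compute. Qed.

Lemma sublists_uniq s t : uniq s -> t \in sublists s -> uniq t /\ {subset t <= s}.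
Proof.
elim: s t => [|x s IHs] t /=; first by rewrite inE => _ /eqP->.
case/andP=> xs U; rewrite mem_cat => /orP[/(IHs _ U)[Ut sub] | /mapP[t' /(IHs _ U)[Ut sub] ->]].
  by split=> // y /sub; rewrite inE orbC => ->.
split; first by rewrite /= Ut andbT; apply: contra xs => /sub.
by move=> y; rewrite !inE => /orP[-> // | /sub->]; rewrite orbT.
Qed.

Lemma iso_checkP S r1 s n r2 : uniq s -> isomorphic S (list_graph r1 s) ->
  iso_check r1 s n r2 -> isomorphic S (ord_graph n r2).
Proof.
move=> U isoS; rewrite /iso_check; case: eqP => // sz em.
exact: isomorphic_trans isoS (embeds_iso U sz em).
Qed.

Lemma claw_heavy_check n r :
  ~~ embeds (light_adj claw_rel n r) n (iota 0 4) [::] -> heavy claw (ord_graph n r).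
Proof.
move=> nemb; apply: NNPP => nh; case/negP: nemb; apply: light_embeds nh _ _ => //.
by apply: isomorphic_sym; apply: (@embeds_iso claw_rel 4 claw_rel (iota 0 4)) => //.
Qed.

(** * Necessity of the listed pairs *)

Section Necessity.

Variable S : sgraph.
Hypotheses (S_conn : connected_graph S) (S_ge3 : 2 < #|S|).
Hypothesis S_neq_P3 : ~ isomorphic S (path_graph 3).

Lemma light_k23 : ~ heavy S (ord_graph 5 k23) -> isomorphic S claw.
Proof.
move=> nh; have [s s_in isoS] := light_sublist nh.
have [U _] := sublists_uniq (iota_uniq 0 5) s_in.
have := allP claw_check_all s s_in; rewrite /claw_check.
have -> : size s <= 2 = false by rewrite leqNgt -[size s]card_ord -(card_iso isoS) S_ge3.
rewrite (negPf (connected_list_graph U (connected_iso isoS S_conn))).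
case: ifP => [/(iso_checkP U isoS) // | _].
case: ifP => [/(iso_checkP U isoS) // | _].
by rewrite (light_embeds nh U isoS).
Qed.

Lemma light_partner : ~ heavy S (ord_graph 9 p333) -> ~ heavy S (ord_graph 9 pTTT) ->
  ~ heavy S (ord_graph 14 pK8) -> heavy_partner S.
Proof.
move=> nh1 nh2 nh3; have [s s_in isoS] := light_sublist nh1.
have [U _] := sublists_uniq (iota_uniq 0 9) s_in.
have := allP partner_check_all s s_in; rewrite /partner_check.
have -> : size s <= 2 = false by rewrite leqNgt -[size s]card_ord -(card_iso isoS) S_ge3.
rewrite (negPf (connected_list_graph U (connected_iso isoS S_conn))).
case: ifP => [/(iso_checkP U isoS) // | _].
rewrite (light_embeds nh2 U isoS) (light_embeds nh3 U isoS).
case: ifP => // + _; rewrite /heavy_partner.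
have iso := iso_checkP U isoS.
rewrite /partners /= orbF.
by do ?[case/orP; first by move/iso; auto 10]; move/iso; auto 10.
Qed.

End Necessity.

Lemma not_ham n r : ~~ ham_search r n 0 (iota 1 n) -> ~ hamiltonian (ord_graph n.+1 r).
Proof. by move=> /negP nh /ham_searchP. Qed.

Lemma pK8_not_ham : ~ hamiltonian (ord_graph 14 pK8).
Proof. by apply: not_ham; vm_compute. Qed.

Theorem theorem5 (R S : sgraph)
  (R_conn : connected_graph R) (S_conn : connected_graph S)
  (R_ge3 : 2 < #|R|) (S_ge3 : 2 < #|S|)
  (R_neq_P3 : ~ isomorphic R (path_graph 3))
  (S_neq_P3 : ~ isomorphic S (path_graph 3)) :
  (forall G : sgraph, kconnected 2 G -> family_heavy (pair_family R S) G ->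
     hamiltonian G)
  <-> (isomorphic R claw /\ heavy_partner S)
      \/ (isomorphic S claw /\ heavy_partner R).
Proof.
split=> [ham | [[isoR pS] | [isoS pR]] G G2 hG]; last first.
- apply: hamiltonian_of_heavy => //.
    by apply/claws_heavyP/(heavy_iso isoS)/hG; right.
  by apply: (partner_heavy pR); apply: hG; left.
- apply: hamiltonian_of_heavy => //.
    by apply/claws_heavyP/(heavy_iso isoR)/hG; left.
  by apply: (partner_heavy pS); apply: hG; right.
have not_heavy n r : 1 < n -> all (connected_without n.+1 r) (iota 0 n.+2) ->
    ~ hamiltonian (ord_graph n.+1 r) ->
    ~ (heavy R (ord_graph n.+1 r) /\ heavy S (ord_graph n.+1 r)).
  move=> n2 conn nham [hR hS]; apply: nham; apply: ham; first exact: kconnected2P.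
  by move=> H [] ->.
have claw_case R' S' : connected_graph S' -> 2 < #|S'| -> ~ isomorphic S' (path_graph 3) ->
    isomorphic R' claw -> (forall n r, 1 < n -> all (connected_without n.+1 r) (iota 0 n.+2) ->
    ~ hamiltonian (ord_graph n.+1 r) ->
    ~ (heavy R' (ord_graph n.+1 r) /\ heavy S' (ord_graph n.+1 r))) -> heavy_partner S'.
  move=> S'_conn S'3 S'P3 isoR' nh.
  (* In a claw-heavy 2-connected graph that is not Hamiltonian, the second graph of the pair cannot
     be heavy. *)
  have light n r : 1 < n -> all (connected_without n.+1 r) (iota 0 n.+2) ->
      ~ hamiltonian (ord_graph n.+1 r) ->
      ~~ embeds (light_adj claw_rel n.+1 r) n.+1 (iota 0 4) [::] ->
      ~ heavy S' (ord_graph n.+1 r).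
    move=> n2 conn nham /claw_heavy_check hc hS'; apply: (nh n r) => //; split=> //.
    exact: heavy_iso (isomorphic_sym isoR') hc.
  apply: light_partner => //; apply: light; try exact: pK8_not_ham; try by vm_compute.
    by apply: not_ham; vm_compute.
  by apply: not_ham; vm_compute.
(* $K_{2,3}$ is 2-connected and not Hamiltonian, so [R] or [S] fails to be heavy in it and must be
   the claw. *)
have nh23 : ~ (heavy R (ord_graph 5 k23) /\ heavy S (ord_graph 5 k23)).
  by apply: not_heavy; [| vm_compute | apply: not_ham; vm_compute].
case: (not_and_or _ _ nh23) => /light_k23.
  move=> isoR; left; have {}isoR := isoR R_conn R_ge3 R_neq_P3; split=> //.
  exact: claw_case isoR not_heavy.
move=> isoS; right; have {}isoS := isoS S_conn S_ge3 S_neq_P3; split=> //.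
apply: claw_case isoS _ => // n r n2 conn nham [hS hR].
by apply: (not_heavy n r).
Qed.
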